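(* Let $k$ be the residue field, of characteristic $p>2$, of a $p$-modular system. The composition series of the $P_p^k(p-1)$-module $\Delta_\emptyset^k(p;p-1)$ is $$0\subset\Delta_{(p)}^k(p;p-1)\subset\Delta_\emptyset^k(p;p-1),$$ where $\Delta_{(p)}^k(p;p-1)$ is identified with an isomorphic submodule of $\Delta_\emptyset^k(p;p-1)$.
   Context: A $p$-modular system $(K,R,k)$ consists of a discrete valuation ring $R$ with maximal ideal $(\pi)$, field of fractions $K$ of characteristic $0$ and residue field $k=R/(\pi)$ of characteristic $p$. The parameter $p-1$ is regarded as an element of $k$. Partition algebra: $P_n^k(\delta)$ is the $k$-algebra with basis the set-partitions of $\{1,\dots,n,\bar1,\dots,\bar n\}$ (diagrams with northern nodes $1,\dots,n$ and southern nodes $\bar1,\dots,\bar n$); the product $xy$ is obtained by placing $x$ on top of $y$, identifying southern nodes of $x$ with northern nodes of $y$, removing the $t$ blocks lying entirely in the middle row, and multiplying by $\delta^t$. A block of a diagram is propagating if it contains both a northern and a southern node. Cell modules: for a partition $\lambda\vdash t\le n$, let $V(n,t)$ be the $k$-vector space with basis the diagrams having exactly $t$ propagating blocks and in which $\overline{t+1},\dots,\bar n$ are singleton blocks; $\mathfrak{S}_t$ acts on the right by permuting the southern nodes $\bar1,\dots,\bar t$. Put $\Delta_\lambda^k(n;\delta)=V(n,t)\otimes_{\mathfrak{S}_t}S^\lambda_k$, where $S^\lambda_k$ is the Specht module (James' convention, so $S^{(t)}_k$ is trivial), with $x(v\otimes s)=(xv)\otimes s$ if $xv$ has $t$ propagating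 blocks and $0$ otherwise. $\emptyset$ is the empty partition of $0$ and $(p)$ the one-row partition of $p$. *)

(* Defs.v *)
From HB Require Import structures.
From mathcomp Require Import all_boot all_order all_fingroup all_algebra.

Set Implicit Arguments.
Unset Strict Implicit.
Unset Printing Implicit Defensive.

Import GRing.Theory.
Local Open Scope ring_scope.

(** * p-modular systems *)

Section DVR.
Variable R : idomainType.

Definition is_ideal (I : R -> Prop) : Prop :=
  [/\ I 0, forall a b, I a -> I b -> I (a + b) & forall r a, I a -> I (r * a)].

Definition principal_ideal (a : R) : R -> Prop := fun x => exists r, x = r * a.

(* A local principal ideal domain which is not a field; a ring is local with
   maximal ideal (pi) iff the non-units are exactly the elements of (pi). *)
Definition is_dvr (pi : R) : Prop :=
  [/\ forall I, is_ideal I -> exists a, forall x, I x <-> principal_ideal a x,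
      forall x, x \isn't a GRing.unit <-> principal_ideal pi x
    & pi != 0].

End DVR.

(* K is the field of fractions of R through pms_frac, and k is R/(pi) through
   pms_res. *)
Record pmodular_system (p : nat) (K : fieldType) (R : idomainType)
    (k : fieldType) := PModularSystem {
  pms_pi : R;
  pms_frac : {rmorphism R -> K};
  pms_res : {rmorphism R -> k};
  pms_dvr : is_dvr pms_pi;
  pms_frac_inj : injective pms_frac;
  pms_frac_surj : forall z : K, exists a b : R,
    b != 0 /\ z = pms_frac a / pms_frac b;
  pms_res_surj : forall c : k, exists a : R, c = pms_res a;
  pms_res_ker : forall a : R, pms_res a = 0 <-> principal_ideal pms_pi a;
  pms_pcharK : [pchar K] =i pred0;
  pms_pchark : p \in [pchar k] }.

(** * Quotients of finite dimensional vector spaces *)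

Section Quotient.
Variables (k : fieldType) (V : vectType k) (W : {vspace V}).

(* V / W, realised on a complement of W; [quot_pi] is the canonical surjection,
   i.e. the projection along W, and [vsval] is a linear section of it. *)
Definition quotv : vectType k := subvs_of (W^C)%VS.
Definition quot_pi (v : V) : quotv := vsproj (W^C)%VS (daddv_pi (W^C)%VS W v).

Let capCW : (W^C :&: W)%VS = 0%VS.
Proof. by rewrite capvC capv_compl. Qed.

Lemma quot_pi_is_linear : linear quot_pi.
Proof. by move=> c u v; rewrite /quot_pi !linearP. Qed.

Lemma quot_pi_val (u : quotv) : quot_pi (vsval u) = u.
Proof.
by rewrite /quot_pi daddv_pi_id ?subvsP ?capCW //; apply: vsvalK.
Qed.

Lemma quot_pi_eq0 v : (quot_pi v == 0) = (v \in W).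
Proof.
have vE : daddv_pi (W^C)%VS W v + daddv_pi W (W^C)%VS v = v.
  by apply: daddv_pi_add; rewrite ?capCW // addvC addv_complf memvf.
apply/eqP/idP => [v0 | vW].
  have: vsval (quot_pi v) = 0 by rewrite v0 linear0.
  rewrite vsprojK ?memv_pi // => p0.
  by rewrite -vE p0 add0r memv_pi.
have pW : daddv_pi (W^C)%VS W v \in W.
  by rewrite -[X in X \in _](addrK (daddv_pi W (W^C)%VS v)) vE rpredB ?memv_pi.
have: daddv_pi (W^C)%VS W v \in (W^C :&: W)%VS by rewrite memv_cap memv_pi.
by rewrite capCW memv0 /quot_pi => /eqP ->; rewrite linear0.
Qed.

End Quotient.

Lemma linear_mem_vbasis (k : fieldType) (U V : vectType k) (f : U -> V)
    (W : {vspace V}) :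
  linear f -> (forall u, u \in vbasis fullv -> f u \in W) ->
  forall u, f u \in W.
Proof.
move=> lf fW u; pose g : {linear U -> V} := HB.pack f
  (GRing.isLinear.Build k U V *:%R f lf).
rewrite -[f]/(g : U -> V) (coord_vbasis (memvf u)) linear_sum.
apply: rpred_sum => i _; rewrite linearZ; apply: rpredZ.
by apply/fW/mem_nth; rewrite size_tuple.
Qed.

Lemma linear_sub_comp (k : fieldType) (U V W : vectType k)
    (f : U -> W) (g : V -> W) (h : U -> V) :
  linear f -> linear g -> linear h -> linear (fun u => f u - g (h u)).
Proof.
by move=> lf lg lh c u v; rewrite lf lh lg scalerBr opprD addrACA.
Qed.

(** * Modules and composition series *)

(* V is a module over an algebra with underlying set A, acting through act. *)
Section Modules.
Variables (k : fieldType) (A : Type) (V : vectType k) (act : A -> V -> V).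
Implicit Types U W : {vspace V}.

Definition submodule U : Prop := forall a v, v \in U -> act a v \in U.

Definition maximal_submodule U W : Prop :=
  [/\ submodule U, (U <= W)%VS, U != W
    & forall X, submodule X -> (U <= X)%VS -> (X <= W)%VS -> X = U \/ X = W].

Definition composition_series (s : seq {vspace V}) : Prop :=
  [/\ ohead s = Some 0%VS, last 0%VS s = fullv,
      forall U, U \in s -> submodule U
    & forall i, (i.+1 < size s)%N ->
        maximal_submodule (nth 0%VS s i) (nth 0%VS s i.+1)].

End Modules.

Definition module_hom (k : fieldType) (A : Type) (V W : vectType k)
    (actV : A -> V -> V) (actW : A -> W -> W) (f : 'Hom(V, W)) : Prop :=
  forall a v, f (actV a v) = actW a (f v).

Definition fbasis (k : fieldType) (I : finType) (i : I) : {ffun I -> k^o} :=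
  [ffun j => (j == i)%:R].

(** * Partition diagrams and the partition algebra *)

Section Diagrams.
Variable n : nat.

(* [inl i] is the northern node i and [inr i] the southern node i, numbered
   from 0. *)
Definition node : finType := ('I_n + 'I_n)%type.

Record diagram := Diagram {
  blocks : {set {set node}};
  blocksP : partition blocks [set: node] }.

HB.instance Definition _ := [isSub for blocks].
HB.instance Definition _ := [Finite of diagram by <:].

Definition propagating (B : {set node}) : bool :=
  [exists i, inl i \in B] && [exists j, inr j \in B].

Definition npropag (d : diagram) : nat := #|[set B in blocks d | propagating B]|.

(* Nodes of x stacked on top of y: [inl (inl _)] is the top row, [inl (inr _)]
   the middle row and [inr _] the bottom row. *)
Definition stack_node : finType := (node + 'I_n)%type.

Definition upper (u : node) : stack_node := inl u.
Definition lower (u : node) : stack_node :=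
  match u with inl i => inl (inr i) | inr i => inr i end.
Definition outer (u : node) : stack_node :=
  match u with inl i => inl (inl i) | inr i => inr i end.
Definition middle (i : 'I_n) : stack_node := inl (inr i).

Definition stack_edge (x y : diagram) : rel stack_node := fun a b =>
  [exists B in blocks x, (a \in upper @: B) && (b \in upper @: B)]
  || [exists B in blocks y, (a \in lower @: B) && (b \in lower @: B)].

Definition stack_blocks (x y : diagram) : {set {set stack_node}} :=
  equivalence_partition (connect (stack_edge x y)) [set: stack_node].

Definition loops (x y : diagram) : nat :=
  #|[set B in stack_blocks x y | B \subset [set middle i | i : 'I_n]]|.

Definition dmul_blocks (x y : diagram) : {set {set node}} :=
  equivalence_partition
    (fun u v => connect (stack_edge x y) (outer u) (outer v)) [set: node].

Lemma stack_edge_sym x y : symmetric (stack_edge x y).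
Proof.
move=> a b; rewrite /stack_edge; congr (_ || _);
  by apply: eq_existsb => B; rewrite [X in _ && X]andbC.
Qed.

Lemma stack_equiv x y : equivalence_rel (connect (stack_edge x y)).
Proof.
apply/equivalence_relP; split; first exact: connect0.
move=> a b ab c; apply: (same_connect _ ab).
exact/sym_connect_sym/stack_edge_sym.
Qed.

Lemma dmul_subproof x y : partition (dmul_blocks x y) [set: node].
Proof.
by apply: equivalence_partitionP => u v w _ _ _; apply: stack_equiv.
Qed.

Definition dmul (x y : diagram) : diagram := Diagram (dmul_subproof x y).

End Diagrams.

Section PartitionAlgebra.
Variables (k : fieldType) (delta : k) (n : nat).

Definition palg : vectType k := {ffun diagram n -> k^o}.

Definition pmul (a b : palg) : palg :=
  \sum_x \sum_y (a x * b y * delta ^+ loops x y) *: fbasis k (dmul x y).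

End PartitionAlgebra.

(** * Specht modules *)

(* Zero parts are allowed and immaterial. *)
Record intpartn (t : nat) := IntPartn {
  parts :> seq nat;
  _ : sorted geq parts && (sumn parts == t) }.

Definition empty_partn : intpartn 0 := @IntPartn 0 [::] isT.

Lemma row_partn_subproof t : sorted geq [:: t] && (sumn [:: t] == t).
Proof. by rewrite /= addn0 eqxx. Qed.

Definition row_partn t : intpartn t := IntPartn (row_partn_subproof t).

Section Specht.
Variables (k : fieldType) (t : nat) (la : intpartn t).

(* The cells of the diagram of la are numbered 0, ..., t-1 row by row, so a
   tableau is a permutation T, sending each entry to the cell containing it. *)
Implicit Types T U : 'S_t.

Definition tab_row T (e : 'I_t) : nat := reshape_index la (T e).
Definition tab_col T (e : 'I_t) : nat := reshape_offset la (T e).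

(* The row equivalence class of T. *)
Definition tabloid T : {set 'S_t} :=
  [set U | [forall e, tab_row U e == tab_row T e]].

Definition col_stab T : {set 'S_t} :=
  [set s : 'S_t | [forall e, tab_col T (s e) == tab_col T e]].

(* M^la is the span of the [fbasis k (tabloid T)].  Products of permutations
   compose from left to right, so that T |-> s * T, i.e. replacing T by
   e |-> T (s e), is a left action. *)
Definition tabloid_space : vectType k := {ffun {set 'S_t} -> k^o}.

Definition tabloid_act (s : 'S_t) (m : tabloid_space) : tabloid_space :=
  \sum_X m X *: fbasis k [set (s * T)%g | T in X].

Definition polytabloid T : tabloid_space :=
  \sum_(s in col_stab T) (-1) ^+ s *: fbasis k (tabloid (s * T)%g).

Definition specht_vspace : {vspace tabloid_space} :=
  <<[seq polytabloid T | T : 'S_t]>>%VS.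

Lemma tabloid_act_is_linear s : linear (tabloid_act s).
Proof.
move=> c m1 m2; rewrite scaler_sumr -big_split; apply: eq_bigr => X _ /=.
by rewrite !ffunE scalerDl scalerA.
Qed.

HB.instance Definition _ s := GRing.isLinear.Build k tabloid_space tabloid_space
  *:%R (tabloid_act s) (tabloid_act_is_linear s).

Lemma tabloid_act_basis s X :
  tabloid_act s (fbasis k X) = fbasis k [set (s * T)%g | T in X].
Proof.
rewrite /tabloid_act (bigD1 X) //= ffunE eqxx scale1r big1 ?addr0 // => Y.
by rewrite ffunE => /negPf ->; rewrite scale0r.
Qed.

Lemma mul_tabloid s T : [set (s * U)%g | U in tabloid T] = tabloid (s * T)%g.
Proof.
apply/setP=> U; rewrite inE; apply/imsetP/forallP => [[W] | UT].
  rewrite inE => /forallP WT -> e; rewrite /tab_row !permM.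
  exact: WT (s e).
exists (s^-1 * U)%g; last by rewrite mulKVg.
rewrite inE; apply/forallP=> e; have := UT ((s^-1)%g e).
by rewrite /tab_row !permM permKV.
Qed.

Lemma tabloid_act_polytabloid s T :
  tabloid_act s (polytabloid T) = polytabloid (s * T)%g.
Proof.
rewrite /polytabloid linear_sum /=.
rewrite [RHS](reindex_inj (conjg_inj s^-1%g)) /=; apply: eq_big => [r | r _].
  rewrite !inE; apply/forallP/forallP => C e.
    by rewrite /tab_col conjgE invgK !permM permKV; apply: C.
  have := C ((s^-1)%g e); rewrite /tab_col conjgE invgK !permM.
  by rewrite !permKV.
rewrite linearZ /= tabloid_act_basis mul_tabloid odd_permJ conjgE invgK.
by rewrite !mulgA mulgKV.
Qed.

(* Hence the projection in [specht_act] below is the identity on the vectors it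
   is applied to. *)
Lemma specht_stable s m :
  m \in specht_vspace -> tabloid_act s m \in specht_vspace.
Proof.
move/coord_span=> ->; rewrite linear_sum /= rpred_sum // => i _.
rewrite linearZ /= rpredZ //.
set X := [seq polytabloid T | T : 'S_t].
have /imageP[T _ ->] : X`_i \in X by rewrite mem_nth // size_tuple.
rewrite tabloid_act_polytabloid; apply/memv_span/imageP.
by exists (s * T)%g.
Qed.

Definition specht : vectType k := subvs_of specht_vspace.

Definition specht_act (s : 'S_t) (u : specht) : specht :=
  vsproj specht_vspace (tabloid_act s (vsval u)).

Lemma specht_act_is_linear s : linear (specht_act s).
Proof. by move=> c u v; rewrite /specht_act !linearP. Qed.

HB.instance Definition _ s := GRing.isLinear.Build k specht specht
  *:%R (specht_act s) (specht_act_is_linear s).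

End Specht.

(** * Cell modules *)

Section CellBasis.
Variables (n t : nat) (le_tn : (t <= n)%N).

Definition is_cell_diagram (d : diagram n) : bool :=
  (npropag d == t)
  && [forall j : 'I_n, (t <= j)%N ==> ([set inr j] \in blocks d)].

Record cell_diagram := CellDiagram {
  cell_diag :> diagram n;
  cell_diagP : is_cell_diagram cell_diag }.

HB.instance Definition _ := [isSub for cell_diag].
HB.instance Definition _ := [Finite of cell_diagram by <:].

(* The action on nodes of a permutation of the first t southern nodes. *)
Definition south_perm (s : 'S_t) (u : node n) : node n :=
  match u with
  | inl i => inl i
  | inr j => inr (if insub (val j) is Some i then widen_ord le_tn (s i) else j)
  end.

Lemma south_permK s : cancel (south_perm s) (south_perm s^-1%g).
Proof.
case=> //= j; congr inr; case: (insubP 'I_t (val j)) => [i _ ij | jt] /=.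
  have -> : insub (val (s i)) = Some (s i) by rewrite valK.
  by rewrite permK; apply: val_inj.
by rewrite insubN.
Qed.

Definition diag_perm_blocks (d : diagram n) (s : 'S_t) : {set {set node n}} :=
  [set south_perm s @: B | B : {set node n} in blocks d].

Lemma diag_perm_subproof d s : partition (diag_perm_blocks d s) [set: node n].
Proof.
have inj := can_inj (south_permK s).
have -> : [set: node n] = south_perm s @: [set: node n].
  apply/eqP; rewrite eq_sym eqEcard subsetT /=.
  by rewrite card_imset.
by rewrite /diag_perm_blocks imset_partition ?blocksP //; apply: in2W.
Qed.

Definition diag_perm d s : diagram n := Diagram (diag_perm_subproof d s).

Lemma cell_perm_subproof (d : cell_diagram) s :
  is_cell_diagram (diag_perm d s).
Proof.
have inj := can_inj (south_permK s).
case/andP: (cell_diagP d) => /eqP dt /forallP dS; apply/andP; split.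
  rewrite -dt /npropag; apply/eqP.
  rewrite -[RHS](card_imset _ (imset_inj inj)); apply: eq_card => B.
  have propE (C : {set node n}) : propagating (south_perm s @: C) = propagating C.
    have E (r : 'S_t) (D : {set node n}) :
        propagating D -> propagating (south_perm r @: D).
      case/andP=> /existsP[i iD] /existsP[j jD]; apply/andP; split.
        by apply/existsP; exists i; apply/imsetP; exists (inl i).
      apply/existsP; eexists; apply/imsetP; exists (inr j) => //=.
    apply/idP/idP; last exact: E.
    move/(E s^-1%g); rewrite -imset_comp.
    by rewrite (eq_imset (g := id)) ?imset_id // => u /=; rewrite south_permK.
  rewrite inE; apply/andP/imsetP => [[/imsetP[C Cd ->] pC] | [C]].
    by exists C => //; rewrite inE Cd -propE.
  rewrite inE => /andP[Cd pC] ->; rewrite propE; split=> //.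
  exact: imset_f.
apply/forallP=> j; apply/implyP=> tj; apply/imsetP; exists [set inr j].
  exact: implyP (dS j) tj.
by rewrite imset_set1 /= insubN // -leqNgt.
Qed.

Lemma dmul_south_singleton (x y : diagram n) (j : 'I_n) :
  [set inr j] \in blocks y -> [set inr j] \in blocks (dmul x y).
Proof.
move=> jy; apply/imsetP; exists (inr j) => //.
have conn a : connect (stack_edge x y) (inr j) a -> a = inr j.
  case/connectP=> q; elim/last_ind: q a => [a _ // | q b IH a].
  rewrite rcons_path last_rcons => /andP[qp e] ->; move: e.
  rewrite (IH _ qp (erefl _)).
  case/orP=> /exists_inP[B By /andP[/imsetP[u uB E] /imsetP[v vB ->]]].
    by [].
  case: u uB E => // j' jB [Ej]; rewrite -Ej in jB.
  suff BE : B = [set inr j] by move: vB; rewrite BE inE => /eqP ->.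
  have [_ tI _] := and3P (blocksP y).
  by rewrite -(def_pblock tI By jB) (def_pblock tI jy) // inE.
apply/setP=> u; rewrite !inE /=; apply/eqP/idP => [-> | /conn].
  exact: connect0.
by case: u => //= j' [->].
Qed.

Lemma dmul_cell (x : diagram n) (d : cell_diagram) :
  npropag (dmul x d) = t -> is_cell_diagram (dmul x d).
Proof.
move=> xt; rewrite /is_cell_diagram xt eqxx; apply/forallP=> j.
apply/implyP=> tj; apply: dmul_south_singleton.
by have /andP[_ /forallP/(_ j)/implyP/(_ tj)] := cell_diagP d.
Qed.

(* A right action, as products of permutations compose from left to right. *)
Definition cell_perm (d : cell_diagram) s : cell_diagram :=
  CellDiagram (cell_perm_subproof d s).

End CellBasis.

Section CellModule.
Variables (k : fieldType) (delta : k) (n t : nat) (le_tn : (t <= n)%N).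
Variable la : intpartn t.

(* V(n, t) *)
Definition cell_space : vectType k := {ffun cell_diagram n t -> k^o}.

Definition cell_incl (v : cell_space) : palg k n :=
  \sum_d v d *: fbasis k (cell_diag d).

(* The product in the partition algebra, in which the diagrams that do not have
   t propagating blocks are discarded (see [dmul_cell]). *)
Definition cell_act (a : palg k n) (v : cell_space) : cell_space :=
  [ffun d => pmul delta a (cell_incl v) (cell_diag d)].

(* The tensor product over k of V(n, t) and the Specht module, as the functions
   from the diagram basis of V(n, t) to the Specht module. *)
Definition tensor_space : vectType k :=
  {ffun cell_diagram n t -> specht k la}.

Definition tens (v : cell_space) (u : specht k la) : tensor_space :=
  [ffun d => v d *: u].

Definition tensor_act (a : palg k n) (w : tensor_space) : tensor_space :=
  \sum_d tens (cell_act a (fbasis k d)) (w d).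

(* The span of the vs (x) u - v (x) su, for v a diagram, s in S_t and u in a
   basis of the Specht module. *)
Definition balanced_rel : {vspace tensor_space} :=
  (\sum_(d : cell_diagram n t) \sum_(s : 'S_t)
    <<[seq tens (fbasis k (cell_perm le_tn d s)) u
           - tens (fbasis k d) (specht_act s u) | u <- vbasis fullv]>>)%VS.

Lemma tens_is_linear v : linear (tens v).
Proof.
move=> c u w; apply/ffunP=> d.
rewrite [LHS]ffunE [RHS]ffunE [X in _ = X + _]ffunE [X in _ = _ + X]ffunE.
by rewrite [X in _ = _ *: X + _]ffunE scalerDr !scalerA [c * _]mulrC.
Qed.

Lemma balanced_relP d s u :
  tens (fbasis k (cell_perm le_tn d s)) u - tens (fbasis k d) (specht_act s u)
    \in balanced_rel.
Proof.
apply: (linear_mem_vbasis (linear_sub_comp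
  (tens_is_linear (fbasis k (cell_perm le_tn d s)))
  (tens_is_linear (fbasis k d)) (specht_act_is_linear s))) => v vX.
apply: (subvP (sumv_sup d _ (sumv_sup s _ (subvv _)))); [by []|by []|].
by apply/memv_span/map_f.
Qed.

Definition Delta : vectType k := quotv balanced_rel.

Definition Delta_act (a : palg k n) (w : Delta) : Delta :=
  quot_pi balanced_rel (tensor_act a (vsval w)).

End CellModule.

(* Main.v *)
Require Import Defs.
From HB Require Import structures.
From mathcomp Require Import all_boot all_order all_fingroup all_algebra.

Set Implicit Arguments.
Unset Strict Implicit.
Unset Printing Implicit Defensive.

Import GRing.Theory.
Local Open Scope ring_scope.

(** Set partitions of the p northern nodes form a basis of Delta_0, and the
    whole argument takes place in coordinates for this basis ([to_cell]).
    Let T be a set of p - 1 colours.  Sending a set partition to the indicator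
    function of the colourings of the nodes that are constant on its blocks is
    the map Delta_0 -> V^{(x) p}, dim V = p - 1, of Schur-Weyl duality; its
    coordinate at a colouring [c] is [colour _ c].  It is compatible with the
    diagrams because a diagram acts on functions of colourings through the 0-1
    matrix [compat x (glue a b)], and composing two such matrices counts the
    colourings of the middle row: each removed loop gives one free choice among
    p - 1 colours ([card_compat_stack]).

    The coordinate at [c] depends only on the kernel tau of [c]: it is the sum
    [orbit_coef tau] of the coefficients of the set partitions finer than tau.
    As p nodes cannot be coloured injectively with p - 1 colours, the kernel of
    the map is given by the equations [orbit_coef tau u = 0] for tau different
    from the partition [disc_cell] into singletons ([singular]).  There is one
    equation fewer than there are unknowns, and the system is triangular for
    refinement, so the solutions form a line, spanned by some w whose
    coefficient at [disc_cell] is nonzero.  Each diagram x hence multiplies w by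
    a scalar.  If x is a permutation diagram, comparing coefficients at
    [disc_cell] gives 1.  Otherwise x joins two northern nodes, and then x w has
    no coefficient at [disc_cell], or it isolates a northern node i, and then
    x w has no coefficient at the partition with unique nontrivial block {i, j},
    where w has the opposite of its coefficient at [disc_cell]; either way the
    scalar is 0 ([singular_act]).

    On the other side Delta_(p) is a line: its diagrams are the permutation
    diagrams, they are all identified by the symmetric group, and the sum of the
    coordinates ([Delta_augment]) is an isomorphism to k on which a permutation
    diagram acts by 1 and any other diagram by 0.  So u |-> Delta_augment u w is
    the required embedding.

    Finally let U be a submodule that contains some u not proportional to w.
    The diagram without propagating blocks with northern part d and southern
    part v maps u to a multiple of d, with a factor <v, u> that does not depend
    on d ([act_outerdiag]).  In terms of colourings <v, u> is the sum of
    [colour u b] over the [b] constant on the blocks of v; for v the coarsest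
    partition with [orbit_coef v u] nonzero this is a single orbit coefficient
    times the number (p-1)(p-2)... of colourings with kernel v, which is prime
    to p ([form_nonzero]).  So U contains every d, and the only submodules are
    0, the line of w and Delta_0. *)

(** * Diagrams as equivalence relations, and their colourings *)

Section Linked.
Variable n : nat.
Implicit Types (d x y : diagram n) (u v : node n).

Definition linked d u v : bool := v \in pblock (blocks d) u.

Lemma linked_equiv d : equivalence_rel (linked d).
Proof.
by move=> u v w; have := pblock_equivalence (blocksP d); apply; rewrite inE.
Qed.

Lemma linkedxx d u : linked d u u.
Proof. by case: (linked_equiv d u u u). Qed.

Lemma linked_sym d : symmetric (linked d).
Proof. by have /equivalence_relP[r l] := linked_equiv d; move=> u v;
  apply/idP/idP => H; [rewrite -(l _ _ H) | rewrite -(l _ _ H)]; apply: linkedxx. Qed.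

Lemma linked_transl d u v : linked d u v -> linked d u =1 linked d v.
Proof. by have /equivalence_relP[_] := linked_equiv d; apply. Qed.

Lemma linked_block d (B : {set node n}) u v :
  B \in blocks d -> u \in B -> linked d u v = (v \in B).
Proof.
by have [_ tI _] := and3P (blocksP d) => Bd uB; rewrite /linked (def_pblock tI Bd uB).
Qed.

Lemma pblock_blocks d u : pblock (blocks d) u \in blocks d.
Proof. by rewrite pblock_mem // (cover_partition (blocksP d)) inE. Qed.

Lemma diagram_ext d x : linked d =2 linked x -> d = x.
Proof.
move=> dx; apply: val_inj => /=.
rewrite -(equivalence_partition_pblock (blocksP d)).
rewrite -(equivalence_partition_pblock (blocksP x)).
by apply: eq_in_imset => u _; apply/setP=> v; rewrite !inE; apply: dx.
Qed.

Definition kerdiag (S : eqType) (g : node n -> S) : diagram n :=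
  Diagram (preim_partitionP g [set: node n]).

Lemma linked_kerdiag (S : eqType) (g : node n -> S) u v :
  linked (kerdiag g) u v = (g u == g v).
Proof.
rewrite /linked pblock_equivalence_partition ?inE //.
by split=> // /eqP ->.
Qed.

Lemma linked_dmul x y u v :
  linked (dmul x y) u v = connect (stack_edge x y) (outer u) (outer v).
Proof.
rewrite /linked pblock_equivalence_partition ?inE // => a b c _ _ _.
exact: stack_equiv.
Qed.

Lemma linked_dmul_north x y i j :
  linked x (inl i) (inl j) -> linked (dmul x y) (inl i) (inl j).
Proof.
move=> ij; rewrite linked_dmul; apply/connect1/orP; left.
apply/exists_inP; exists (pblock (blocks x) (inl i)); first exact: pblock_blocks.
apply/andP; split; first exact: (imset_f _ (linkedxx x (inl i))).
exact: (imset_f _ ij).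
Qed.

Lemma singleton_dmul_north x y i :
  (forall u, linked x (inl i) u -> u = inl i) ->
  forall u, linked (dmul x y) (inl i) u -> u = inl i.
Proof.
move=> xi u; rewrite linked_dmul => /connectP[q].
elim: q => [_ | r q IH] /=; first by case: u => // j [->].
case/andP=> ir iq; suff E : r = outer (inl i) by move: iq; rewrite E.
case/orP: ir => /exists_inP[B Bx /andP[/imsetP[w wB E] /imsetP[z zB ->]]];
  last by case: w E {wB}.
case: w E wB => // _ [<-] iB.
by rewrite (xi z) // (linked_block _ Bx iB).
Qed.

Lemma singleton_block d u :
  ([set u] \in blocks d) = [forall v, linked d u v ==> (u == v)].
Proof.
apply/idP/forallP => [ud v | ud].
  by rewrite (linked_block _ ud) ?inE // eq_sym implybb.
suff -> : [set u] = pblock (blocks d) u by apply: pblock_blocks.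
apply/setP=> v; rewrite inE; have := ud v; rewrite eq_sym -/(linked d u v).
by case: eqP => [-> _|_]; rewrite ?linkedxx //= implybF => /negPf.
Qed.

End Linked.

Section Compatible.
Variables (n : nat) (T : eqType).
Implicit Types (d x y : diagram n) (u v : node n) (a b c : 'I_n -> T).

Definition compat d (C : node n -> T) : bool :=
  [forall u, forall v, linked d u v ==> (C u == C v)].

Lemma compatP d (C : node n -> T) :
  reflect (forall u v, linked d u v -> C u = C v) (compat d C).
Proof.
apply: (iffP forallP) => [H u v uv | H u].
  by have /forallP/(_ v)/implyP/(_ uv)/eqP := H u.
by apply/forallP=> v; apply/implyP=> /H/eqP.
Qed.

Definition glue a b (u : node n) : T :=
  match u with inl i => a i | inr j => b j end.

Lemma eq_compat d (C C' : node n -> T) : C =1 C' -> compat d C = compat d C'.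
Proof.
by move=> E; apply/compatP/compatP => H u v /H; rewrite !E.
Qed.

Lemma compat_const d (t : T) (C : node n -> T) : C =1 (fun=> t) -> compat d C.
Proof. by move=> E; apply/compatP=> u v _; rewrite !E. Qed.

(** A block is recovered from the colouring that distinguishes its nodes
    from all the others, so two colours are enough to tell diagrams
    apart. *)
Lemma compat_ext d x (t0 t1 : T) : t0 != t1 ->
  (forall a b, compat d (glue a b) = compat x (glue a b)) -> d = x.
Proof.
move=> t01 dx; apply: diagram_ext => u v.
have sub y y' : (forall a b, compat y (glue a b) = compat y' (glue a b)) ->
    linked y u v -> linked y' u v.
  move=> E yuv; apply: contraT => y'uv.
  pose C w := if linked y' u w then t0 else t1.
  have CE : glue (C \o inl) (C \o inr) =1 C by case.
  have /compatP : compat y C.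
    rewrite -(eq_compat _ CE) E (eq_compat _ CE); apply/compatP=> w z wz.
    by rewrite /C linked_sym (linked_transl wz) linked_sym.
  by move/(_ _ _ yuv); rewrite /C linkedxx (negPf y'uv) => /eqP; rewrite (negPf t01).
by apply/idP/idP; apply: sub.
Qed.

End Compatible.

(** * Counting the colourings of the middle row *)

Section Count.
Variables (n : nat) (T : finType) (t0 : T) (x y : diagram n) (a c : 'I_n -> T).

Let e := connect (stack_edge x y).

Definition stack_glue (b : 'I_n -> T) (s : stack_node n) : T :=
  match s with
  | inl (inl i) => a i
  | inl (inr i) => b i
  | inr i => c i
  end.

(** Being constant along the edges of the stack is being constant on its
    connected components. *)
Lemma compat_stack (b : 'I_n -> T) :
  reflect (forall s t, e s t -> stack_glue b s = stack_glue b t)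
    (compat x (glue a b) && compat y (glue b c)).
Proof.
have up u : stack_glue b (upper u) = glue a b u by case: u.
have lo u : stack_glue b (lower u) = glue b c u by case: u.
apply: (iffP andP) => [[/compatP X /compatP Y] s t | H].
  case/connectP=> q; elim: q s t => [|r q IH] s t /=; first by move=> _ ->.
  case/andP=> sr rq tE; rewrite -(IH _ _ rq tE).
  case/orP: sr => /exists_inP[B Bx /andP[/imsetP[u uB ->] /imsetP[v vB ->]]].
    by rewrite !up; apply: X; rewrite (linked_block _ Bx uB).
  by rewrite !lo; apply: Y; rewrite (linked_block _ Bx uB).
split; apply/compatP=> u v uv.
  rewrite -!up; apply/H/connect1/orP; left.
  apply/exists_inP; exists (pblock (blocks x) u); first exact: pblock_blocks.
  by rewrite !imset_f //; apply: linkedxx.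
rewrite -!lo; apply/H/connect1/orP; right.
apply/exists_inP; exists (pblock (blocks y) u); first exact: pblock_blocks.
by rewrite !imset_f //; apply: linkedxx.
Qed.

(** The matrices [compat x (glue a b)], with rows and columns indexed by
    colourings, multiply like diagrams with parameter #|T|.  An admissible
    colouring of the middle row is forced on the components that reach the
    top or the bottom row, where it exists iff [a] and [c] agree along the
    product, and is freely chosen on each of the [loops x y] others. *)
Lemma card_compat_stack :
  #|[set b : {ffun 'I_n -> T} | compat x (glue a b) && compat y (glue b c)]|
  = (compat (dmul x y) (glue a c) * #|T| ^ loops x y)%N.
Proof.
have oj b u : stack_glue b (outer u) = glue a c u by case: u.
have [/compatP acP | nac] := boolP (compat _ _); last first.
  apply/eqP; rewrite mul0n cards_eq0 -subset0; apply/subsetP=> b.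
  rewrite inE => /compat_stack H; case/compatP: nac => u v.
  by rewrite linked_dmul => /H; rewrite !oj.
have eqv := stack_equiv x y; have esym : symmetric e.
  exact/sym_connect_sym/stack_edge_sym.
have part : partition (stack_blocks x y) [set: stack_node n].
  by apply: equivalence_partitionP => s t r _ _ _; apply: eqv.
pose blk := pblock (stack_blocks x y).
have blkE s t : (t \in blk s) = e s t.
  by rewrite /blk pblock_equivalence_partition ?inE // => ? ? ? _ _ _; apply: eqv.
have blk_mem s : blk s \in stack_blocks x y.
  by rewrite pblock_mem // (cover_partition part) inE.
have eblk s t : e s t -> blk s = blk t.
  move=> st; apply/setP=> r; rewrite !blkE; exact: (same_connect _ st).
pose mid := [set middle i | i : 'I_n].
pose Lp := [set B in stack_blocks x y | B \subset mid].
have LpE s : blk s \in Lp = (blk s \subset mid) by rewrite inE blk_mem.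
have outer_mid u : outer u \notin mid.
  by apply/imsetP=> -[j _]; case: u.
(* The colouring of the stack determined by a choice [h] of colours for the
   loops; a component that is not a loop takes its colour from any outer
   node in it. *)
pose g (h : {ffun {set stack_node n} -> T}) s :=
  if blk s \in Lp then h (blk s)
  else if [pick u | e (outer u) s] is Some u then glue a c u else t0.
have ge h s t : e s t -> g h s = g h t.
  move=> st; rewrite /g (eblk _ _ st); case: ifP => // _.
  rewrite (@eq_pick _ _ (fun u => e (outer u) t)) // => u /=.
  by rewrite !(esym (outer u)); apply: (same_connect _ st).
have outerP s : blk s \notin Lp ->
    exists2 u, e (outer u) s & forall h, g h s = glue a c u.
  move=> sL; have sL' := sL; rewrite LpE in sL'.
  rewrite /g (negPf sL); case: pickP => [u us | none]; first by exists u.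
  case/subsetPn: sL' => t; rewrite blkE => st /negP[].
  have /(_ _)/negbT := none _ => no.
  case: t st => [[i|i]|i] st; last 1 first.
  - by have := no (inr i); rewrite esym st.
  - by have := no (inl i); rewrite esym st.
  exact: imset_f.
pose F h : {ffun 'I_n -> T} := [ffun j => g h (middle j)].
have stkF h s : stack_glue (F h) s = g h s.
  have out u : glue a c u = g h (outer u).
    have [|u' u'u ->] := outerP (outer u).
      rewrite LpE; apply/subsetPn; exists (outer u) => //.
      by rewrite blkE; apply: connect0.
    by symmetry; apply: acP; rewrite linked_dmul.
  case: s => [[i|i]|i] /=.
  - exact: (out (inl i)).
  - by rewrite ffunE.
  - exact: (out (inr i)).
have midL B : B \in Lp -> exists j, B = blk (middle j).
  rewrite inE => /andP[BS Bm]; have [_ tI n0] := and3P part.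
  case: (set_0Vmem B) => [B0|[s sB]]; first by rewrite B0 (negPf n0) in BS.
  have /imsetP[j _ sE] := subsetP Bm _ sB; exists j.
  by rewrite -(def_pblock tI BS sB) /blk sE.
(* Families of colours indexed by the loops, padded with [t0] elsewhere, so
   that they are counted by [card_pffun_on]. *)
rewrite mul1n -[RHS](card_pffun_on t0 (mem Lp) (mem T)).
have -> : [set b : {ffun 'I_n -> T} | compat x (glue a b) && compat y (glue b c)]
   = F @: pffun_on t0 (mem Lp) (mem T).
  apply/setP=> b; rewrite inE; apply/idP/imsetP => [/compat_stack bP | [h _ ->]].
    exists [ffun B => if [pick j | (B \in Lp) && (middle j \in B)] is Some j then b j else t0].
      apply/pffun_onP; split=> //.
      apply/supportP=> B BL; rewrite ffunE; case: pickP => // j /andP[BL'].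
      by rewrite BL' in BL.
    apply/ffunP=> j; rewrite ffunE.
    have [jL|jL] := boolP (blk (middle j) \in Lp); last first.
      by have [u uj ->] := outerP _ jL; rewrite -(oj b) (bP _ _ uj).
    rewrite /g jL ffunE; case: pickP => [i|/(_ j)]; rewrite jL blkE /=.
      by move/bP.
    by rewrite /e connect0.
  by apply/compat_stack=> s t; rewrite !stkF; apply: ge.
apply: card_in_imset => h h' /pffun_onP[hS _] /pffun_onP[h'S _] hh.
apply/ffunP=> B; have [BL|BL] := boolP (B \in Lp); last first.
  by rewrite (supportP hS) ?(supportP h'S).
have [j Bj] := midL _ BL; have /ffunP/(_ j) := hh.
by rewrite !ffunE /g -Bj BL.
Qed.

End Count.

(** * Permutation diagrams *)

Section Permutations.
Variable n : nat.
Implicit Types (d x y : diagram n) (s : 'S_n).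

Definition permdiag s : diagram n := kerdiag (glue s id).

Lemma compat_permdiag (T : eqType) s (a c : 'I_n -> T) :
  compat (permdiag s) (glue a c) = [forall i, a i == c (s i)].
Proof.
apply/compatP/forallP => [H i | H].
  by apply/eqP/(H (inl i) (inr (s i))); rewrite linked_kerdiag /=.
have E u : glue a c u = c (glue s id u) by case: u => i //=; apply/eqP.
by move=> u v; rewrite linked_kerdiag !E => /eqP ->.
Qed.

Let north d (i : 'I_n) := pblock (blocks d) (inl i).
Let south d (j : 'I_n) := pblock (blocks d) (inr j).

Let prop_north d : [set B in blocks d | propagating B] \subset north d @: setT.
Proof.
apply/subsetP=> B; rewrite inE => /and3P[Bd /existsP[i iB] _].
apply/imsetP; exists i => //; rewrite /north.
by have [_ tI _] := and3P (blocksP d); rewrite (def_pblock tI Bd iB).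
Qed.

Let prop_south d : [set B in blocks d | propagating B] \subset south d @: setT.
Proof.
apply/subsetP=> B; rewrite inE => /and3P[Bd _ /existsP[i iB]].
apply/imsetP; exists i => //; rewrite /south.
by have [_ tI _] := and3P (blocksP d); rewrite (def_pblock tI Bd iB).
Qed.

Let full_inj (f : 'I_n -> {set node n}) d : npropag d = n ->
  [set B in blocks d | propagating B] \subset f @: setT ->
  injective f /\ forall i, propagating (f i).
Proof.
move=> dn sub.
have nE : #|f @: setT| = n.
  apply/eqP; rewrite eqn_leq; apply/andP; split.
    by rewrite -[X in (_ <= X)%N]card_ord -cardsT leq_imset_card.
  by have := subset_leq_card sub; rewrite -/(npropag d) dn.
split.
  have /imset_injP fi : #|f @: setT| == #|[set: 'I_n]|.
    by rewrite nE cardsT card_ord.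
  by move=> i j; apply: fi; rewrite inE.
have /setP E : [set B in blocks d | propagating B] = f @: setT.
  by apply/eqP; rewrite eqEcard sub nE -/(npropag d) dn /=.
by move=> i; have := E (f i); rewrite imset_f // inE => /andP[].
Qed.

(** The blocks of the northern nodes are then n distinct propagating blocks;
    there are never more, since a propagating block is the block of some
    northern node. *)
Lemma npropag_full_intro d :
  (forall i j, linked d (inl i) (inl j) -> i = j) ->
  (forall i, exists j, linked d (inl i) (inr j)) -> npropag d = n.
Proof.
move=> inj conn; apply/eqP; rewrite eqn_leq; apply/andP; split.
  rewrite -[X in (_ <= X)%N](card_ord n) -cardsT.
  exact: leq_trans (subset_leq_card (prop_north d)) (leq_imset_card _ _).
rewrite -[X in (X <= _)%N](card_ord n) -cardsT.
have fi : injective (north d).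
  by move=> i j ij; apply: inj; rewrite /linked -/(north d i) ij; apply: linkedxx.
rewrite -(card_imset setT fi) /npropag; apply/subset_leq_card/subsetP=> _ /imsetP[i _ ->].
rewrite inE pblock_blocks /=; apply/andP; split; apply/existsP.
  by exists i; apply: linkedxx.
by have [j ij] := conn i; exists j.
Qed.

(** The n propagating blocks inject into the northern and into the southern
    nodes, so each node lies in exactly one of them and each of them is a
    pair. *)
Lemma npropag_full d : npropag d = n <-> exists s, d = permdiag s.
Proof.
split=> [dn | [s ->]]; last first.
  apply: npropag_full_intro => [i j | i].
    by rewrite linked_kerdiag => /eqP/perm_inj.
  by exists (s i); rewrite linked_kerdiag /=.
have [ni nP] := full_inj dn (prop_north d).
have [si _] := full_inj dn (prop_south d).
have lkP (u v : node n) : linked d u v -> pblock (blocks d) u = pblock (blocks d) v.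
  by move=> uv; apply/setP=> w; apply: (linked_transl uv).
have conn i : exists j, linked d (inl i) (inr j).
  by have /andP[_ /existsP] := nP i.
pose f i := sval (sigW (conn i)).
have fP i : linked d (inl i) (inr (f i)) by apply: (svalP (sigW (conn i))).
have fi : injective f.
  by move=> i j ij; apply: ni; rewrite /north (lkP _ _ (fP i)) ij -(lkP _ _ (fP j)).
exists (perm fi); apply: diagram_ext => u v; rewrite linked_kerdiag.
have jE w : linked d w (inr (glue (perm fi) id w)).
  by case: w => i /=; rewrite ?permE ?fP // linkedxx.
rewrite (linked_transl (jE u)) linked_sym (linked_transl (jE v)).
apply/idP/eqP => [vu | ->]; last exact: linkedxx.
by apply: si; rewrite /south -(lkP _ _ vu).
Qed.

(** A loop would leave two choices for its colour. *)
Lemma loops_eq0_unique_middle x d : (forall a c : 'I_n -> bool,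
    exists C : bool, #|[set b : {ffun 'I_n -> bool} |
      compat x (glue a b) && compat d (glue b c)]| = C) ->
  loops x d = 0%N.
Proof.
move=> H; have [C] := H xpredT xpredT.
rewrite (card_compat_stack true) (@compat_const _ _ _ true); last by case.
rewrite card_bool mul1n => E.
have : (2 ^ loops x d <= 2 ^ 0)%N by rewrite E; case: C {E}.
by rewrite leq_exp2l // leqn0 => /eqP.
Qed.

Lemma card_permr (x : diagram n) s (T : finType) (a c : 'I_n -> T) :
  #|[set b : {ffun 'I_n -> T} |
      compat x (glue a b) && compat (permdiag s) (glue b c)]|
  = compat x (glue a (c \o s)).
Proof.
pose b0 : {ffun 'I_n -> T} := [ffun i => c (s i)].
have E (b : {ffun 'I_n -> T}) : compat (permdiag s) (glue b c) = (b == b0).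
  rewrite compat_permdiag; apply/forallP/eqP => [H | -> i].
    by apply/ffunP=> i; rewrite ffunE; apply/eqP.
  by rewrite ffunE.
have E0 : compat x (glue a b0) = compat x (glue a (c \o s)).
  by apply: eq_compat => -[] i //=; rewrite ffunE.
case: (boolP (compat x _)) => [H|/negPf H].
  rewrite (_ : [set b | _] = [set b0]) ?cards1 //; apply/setP=> b.
  by rewrite !inE E; case: eqP => [->|_]; rewrite ?andbF // E0 H.
apply/eqP; rewrite cards_eq0 -subset0; apply/subsetP=> b.
by rewrite !inE E andbC; case: eqP => //= ->; rewrite E0 H.
Qed.

Lemma card_perml (y : diagram n) s (T : finType) (a c : 'I_n -> T) :
  #|[set b : {ffun 'I_n -> T} |
      compat (permdiag s) (glue a b) && compat y (glue b c)]|
  = compat y (glue (a \o s^-1%g) c).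
Proof.
pose b0 : {ffun 'I_n -> T} := [ffun i => a (s^-1%g i)].
have E (b : {ffun 'I_n -> T}) : compat (permdiag s) (glue a b) = (b == b0).
  rewrite compat_permdiag; apply/forallP/eqP => [H | -> i].
    by apply/ffunP=> i; rewrite ffunE; have /eqP := H (s^-1%g i); rewrite permKV.
  by rewrite ffunE permK.
have E0 : compat y (glue b0 c) = compat y (glue (a \o s^-1%g) c).
  by apply: eq_compat => -[] i //=; rewrite ffunE.
case: (boolP (compat y _)) => [H|/negPf H].
  rewrite (_ : [set b | _] = [set b0]) ?cards1 //; apply/setP=> b.
  by rewrite !inE E; case: eqP => [->|_] //; rewrite E0 H.
apply/eqP; rewrite cards_eq0 -subset0; apply/subsetP=> b.
by rewrite !inE E; case: eqP => //= ->; rewrite E0 H.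
Qed.

Lemma loops_permr x s : loops x (permdiag s) = 0%N.
Proof. by apply: loops_eq0_unique_middle => a c; rewrite card_permr; eexists. Qed.

Lemma loops_perml s y : loops (permdiag s) y = 0%N.
Proof. by apply: loops_eq0_unique_middle => a c; rewrite card_perml; eexists. Qed.

Lemma compat_dmul_permr x s (T : finType) (t0 : T) (a c : 'I_n -> T) :
  compat (dmul x (permdiag s)) (glue a c) = compat x (glue a (c \o s)).
Proof.
have := card_compat_stack t0 x (permdiag s) a c.
rewrite card_permr loops_permr muln1.
by case: (compat _ _); case: (compat _ _).
Qed.

Lemma compat_dmul_perml y s (T : finType) (t0 : T) (a c : 'I_n -> T) :
  compat (dmul (permdiag s) y) (glue a c) = compat y (glue (a \o s^-1%g) c).
Proof.
have := card_compat_stack t0 (permdiag s) y a c.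
rewrite card_perml loops_perml muln1.
by case: (compat _ _); case: (compat _ _).
Qed.

Lemma npropag_dmul_permr x s :
  npropag (dmul x (permdiag s)) = n <-> npropag x = n.
Proof.
split=> /npropag_full[r E]; apply/npropag_full.
  exists (r * s^-1)%g; apply: (@compat_ext _ _ _ _ false true) => // a c.
  have cE : glue a ((c \o (s^-1)%g) \o s) =1 glue a c by case=> //= i; rewrite permK.
  rewrite -(eq_compat x cE) -(compat_dmul_permr x s false) E !compat_permdiag.
  by apply: eq_forallb => i; rewrite permM.
exists (r * s)%g; apply: (@compat_ext _ _ _ _ false true) => // a c.
rewrite (compat_dmul_permr x s false) E !compat_permdiag.
by apply: eq_forallb => i; rewrite permM.
Qed.

(** Otherwise the northern nodes lie in n distinct propagating blocks. *)
Lemma nonperm_north x : npropag x <> n ->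
  (exists i j, i != j /\ linked x (inl i) (inl j)) \/
  (exists i, forall u, linked x (inl i) u -> u = inl i).
Proof.
move=> xn; case: (boolP [exists i, exists j, (i != j) && linked x (inl i) (inl j)]).
  by case/existsP=> i /existsP[j /andP[]]; left; exists i, j.
rewrite negb_exists => /forallP H; right.
have inj i j : linked x (inl i) (inl j) -> i = j.
  move=> ij; have := H i; rewrite negb_exists => /forallP/(_ j).
  by rewrite ij andbT negbK => /eqP.
case: (boolP [exists i, forall j, ~~ linked x (inl i) (inr j)]).
  case/existsP=> i /forallP Hi; exists i => -[j|j] ij; first by rewrite (inj _ _ ij).
  by have := Hi j; rewrite ij.
rewrite negb_exists => /forallP H'; case: xn; apply: npropag_full_intro => // i.
by have := H' i; rewrite negb_forall => /existsP[j /negPn]; exists j.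
Qed.

End Permutations.

(** * Diagrams without propagating blocks *)

Section TrivialCells.
Variable n : nat.
Implicit Types (x : diagram n) (d v : cell_diagram n 0).

Lemma is_cell_diagram0 (x : diagram n) :
  is_cell_diagram 0 x = [forall j : 'I_n, [set inr j] \in blocks x].
Proof.
apply/andP/forallP => [[_ /forallP H] j | H]; first exact: implyP (H j) isT.
split; last by apply/forallP=> j; apply/implyP.
rewrite cards_eq0 -subset0; apply/subsetP=> B.
rewrite inE => /and3P[Bx /existsP[i iB] /existsP[j jB]].
have [_ tI _] := and3P (blocksP x); move: iB.
by rewrite -(def_pblock tI Bx jB) (def_pblock tI (H j)) inE.
Qed.

Lemma south_singleton d j u : linked d (inr j) u = (u == inr j).
Proof.
have := cell_diagP d; rewrite is_cell_diagram0 => /forallP/(_ j) H.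
by rewrite (linked_block _ H) inE.
Qed.

Definition nlinked d i j := linked d (inl i) (inl j).

Definition ncompat (T : eqType) d (a : 'I_n -> T) : bool :=
  [forall i, forall j, nlinked d i j ==> (a i == a j)].

Lemma ncompatP (T : eqType) d (a : 'I_n -> T) :
  reflect (forall i j, nlinked d i j -> a i = a j) (ncompat d a).
Proof.
apply: (iffP forallP) => [H u v uv | H u].
  by have /forallP/(_ v)/implyP/(_ uv)/eqP := H u.
by apply/forallP=> v; apply/implyP=> /H/eqP.
Qed.

Lemma compat_cell0 (T : eqType) d (a c : 'I_n -> T) :
  compat d (glue a c) = ncompat d a.
Proof.
apply/compatP/ncompatP => [H i j /H // | H [i|i] [j|j] /=]; first exact: H.
- by rewrite linked_sym south_singleton.
- by rewrite south_singleton.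
- by rewrite south_singleton => /eqP[->].
Qed.

Lemma cell0_ext d v : (forall i j, nlinked d i j = nlinked v i j) -> d = v.
Proof.
move=> E; apply/val_inj/diagram_ext => -[i|i] [j|j] /=; first exact: E.
- by rewrite !(linked_sym _ (inl i)) !south_singleton.
- by rewrite !south_singleton.
- by rewrite !south_singleton.
Qed.

Lemma mulcell_subproof x d : is_cell_diagram 0 (dmul x d).
Proof.
have := cell_diagP d; rewrite !is_cell_diagram0 => /forallP H.
by apply/forallP=> j; apply: dmul_south_singleton.
Qed.

Definition mulcell x d : cell_diagram n 0 := CellDiagram (mulcell_subproof x d).

(** The sum type keeps every southern node apart from all other nodes. *)
Lemma kercell_subproof (S : eqType) (g : 'I_n -> S) : is_cell_diagram 0
  (kerdiag (fun u => match u with inl i => inl (g i) | inr j => inr j end : S + 'I_n)).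
Proof.
rewrite is_cell_diagram0; apply/forallP=> j; rewrite singleton_block.
by apply/forallP=> u; rewrite linked_kerdiag; apply/implyP; case: u => // i /eqP[->].
Qed.

Definition kercell (S : eqType) (g : 'I_n -> S) : cell_diagram n 0 :=
  CellDiagram (kercell_subproof g).

Lemma nlinked_kercell (S : eqType) (g : 'I_n -> S) i j :
  nlinked (kercell g) i j = (g i == g j).
Proof. by rewrite /nlinked linked_kerdiag. Qed.

Lemma card_ncompat (T : finType) (t0 : T) x d (a : 'I_n -> T) :
  #|[set b : {ffun 'I_n -> T} | compat x (glue a b) && ncompat d b]|
  = (ncompat (mulcell x d) a * #|T| ^ loops x d)%N.
Proof.
rewrite -(compat_cell0 _ _ (fun=> t0)) -(card_compat_stack t0).
by congr #|pred_of_set _|; apply/setP=> b; rewrite !inE compat_cell0.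
Qed.

(** The set partition into singletons. *)
Definition disc_cell : cell_diagram n 0 := kercell id.
(** The set partition with unique nontrivial block {i, j}. *)
Definition pair_cell (i j : 'I_n) : cell_diagram n 0 :=
  kercell (fun l => if l == j then i else l).

(** The elementary operator that sends every set partition to a multiple of
    [d], with a factor depending on [v] only (see [act_outerdiag]). *)
Definition outerdiag d v : diagram n := kerdiag (fun u =>
  match u with inl i => inl (pblock (blocks d) (inl i))
  | inr j => inr (pblock (blocks v) (inl j)) end : {set node n} + {set node n}).

Lemma linkedE (x : diagram n) (u w : node n) :
  linked x u w = (pblock (blocks x) u == pblock (blocks x) w).
Proof.
apply/idP/eqP => [uw | E]; first by apply/setP=> z; apply: (linked_transl uw).
by rewrite /linked E; apply: linkedxx.
Qed.

Lemma compat_outerdiag (T : eqType) d v (a b : 'I_n -> T) :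
  compat (outerdiag d v) (glue a b) = ncompat d a && ncompat v b.
Proof.
apply/compatP/andP => [H | [/ncompatP Ha /ncompatP Hb] [i|i] [j|j]].
- split; apply/ncompatP=> i j; rewrite /nlinked linkedE => /eqP E.
    by apply: (H (inl i) (inl j)); rewrite linked_kerdiag E.
  by apply: (H (inr i) (inr j)); rewrite linked_kerdiag E.
- by rewrite linked_kerdiag => /eqP[/eqP]; rewrite -linkedE => /Ha.
- by rewrite linked_kerdiag.
- by rewrite linked_kerdiag.
- by rewrite linked_kerdiag => /eqP[/eqP]; rewrite -linkedE => /Hb.
Qed.

Lemma ncompat_ext d v : (forall a : 'I_n -> bool, ncompat d a = ncompat v a) -> d = v.
Proof.
move=> E; apply/val_inj/(@compat_ext _ _ _ _ false true) => // a b.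
by rewrite !compat_cell0.
Qed.

Lemma ncompat_const (T : eqType) d (t : T) : ncompat d (fun=> t).
Proof. exact/ncompatP. Qed.

(** Both sides admit the same 2-colourings: in [card_ncompat], every
    colouring of the northern nodes compatible with [d] leaves the same set
    of colourings of the middle row, which contains the constant ones, and
    every other colouring leaves none. *)
Lemma mulcell_outerdiag d v w : mulcell (outerdiag d v) w = d.
Proof.
apply: ncompat_ext => a.
have := card_ncompat true (outerdiag d v) w a.
have [ad | /negPf ad] := boolP (ncompat d a).
  case: (ncompat _ a) => //; rewrite mul0n => /eqP; rewrite cards_eq0 => /eqP/setP.
  move/(_ [ffun=> true]); rewrite !inE compat_outerdiag ad /=.
  by case/andP; split; apply/ncompatP=> i j; rewrite !ffunE.
case: (ncompat _ a) => //; rewrite mul1n card_bool.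
rewrite (_ : [set _ | _] = set0) ?cards0; last first.
  by apply/setP=> b; rewrite !inE compat_outerdiag ad.
by move/esym/eqP; rewrite expn_eq0.
Qed.

(** The bilinear form on set partitions whose value at [v] and [w] is the
    parameter to the number of blocks of their join, in terms of
    colourings. *)
Lemma card_form (T : finType) (t0 : T) d v w :
  #|[set b : {ffun 'I_n -> T} | ncompat v b && ncompat w b]|
  = (#|T| ^ loops (outerdiag d v) w)%N.
Proof.
rewrite -[RHS]mul1n -[1%N]/(true : nat) -(ncompat_const d t0).
rewrite -{1}(mulcell_outerdiag d v w) -(card_ncompat t0).
congr #|pred_of_set _|; apply/setP=> b; rewrite !inE compat_outerdiag.
by rewrite ncompat_const.
Qed.

Lemma mulcell_perm_disc s d : (mulcell (permdiag s) d == disc_cell) = (d == disc_cell).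
Proof.
have E a : ncompat (mulcell (permdiag s) d) a = ncompat d ((a : 'I_n -> bool) \o s^-1%g).
  by rewrite -!(compat_cell0 _ _ a) (compat_dmul_perml _ _ false).
have ncd (a : 'I_n -> bool) : ncompat disc_cell a.
  by apply/ncompatP=> i j; rewrite nlinked_kercell => /eqP ->.
apply/eqP/eqP => H; apply: ncompat_ext => a; rewrite ncd.
  have := E (a \o s); rewrite H ncd => ->; apply: eq_forallb => i.
  by apply: eq_forallb => j /=; rewrite !permKV.
by rewrite E H ncd.
Qed.

End TrivialCells.

(** * The action in coordinates *)

Section Action.
Variables (k : fieldType) (delta : k) (n t : nat).
Implicit Types (a : palg k n) (v : cell_space k n t).

Lemma cell_actE a v d' : cell_act delta a v d' =
  \sum_x a x * \sum_d v d * delta ^+ loops x d * (dmul x d == d')%:R.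
Proof.
rewrite ffunE /pmul sum_ffunE; apply: eq_bigr => x _; rewrite sum_ffunE mulr_sumr.
under eq_bigr => y _ do rewrite 2!ffunE /cell_incl sum_ffunE mulr_sumr mulr_suml.
under eq_bigr => y _ do rewrite scaler_suml.
rewrite exchange_big /=; apply: eq_bigr => d _.
rewrite (bigD1 (cell_diag d)) //= big1 ?addr0 => [|y /negPf yd].
  by rewrite !ffunE eqxx [_ *: 1]mulr1 /GRing.scale /= !mulrA eq_sym.
by rewrite !ffunE yd [_ *: 0]mulr0 !(mulr0, mul0r) scale0r.
Qed.

Lemma cell_act_fbasis x v d' : cell_act delta (fbasis k x) v d' =
  \sum_d v d * delta ^+ loops x d * (dmul x d == d')%:R.
Proof.
rewrite cell_actE [LHS](bigD1 x) //= [X in _ + X]big1 ?addr0 => [|y /negPf yx].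
  by rewrite ffunE eqxx mul1r.
by rewrite ffunE yx mul0r.
Qed.

Lemma cell_act_basis a v :
  cell_act delta a v = \sum_x a x *: cell_act delta (fbasis k x) v.
Proof.
apply/ffunP=> d; rewrite sum_ffunE cell_actE; apply: eq_bigr => x _.
by rewrite [RHS]ffunE cell_act_fbasis.
Qed.

End Action.

(** * Singular vectors *)

Section Refinement.
Variables (k : fieldType) (n : nat).
Local Notation cell0 := (cell_diagram n 0).
Implicit Types (d v tau : cell0) (u : cell_space k n 0).

Definition links d := [set ij : 'I_n * 'I_n | nlinked d ij.1 ij.2].

Definition refines d tau := links d \subset links tau.

Lemma links_inj : injective links.
Proof.
by move=> d v /setP E; apply: cell0_ext => i j; have := E (i, j); rewrite !inE.
Qed.

Lemma ncompat_refines (S : eqType) d (c : 'I_n -> S) :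
  ncompat d c = refines d (kercell c).
Proof.
apply/ncompatP/subsetP => [H [i j] | H i j ij].
  by rewrite !inE nlinked_kercell => /H ->.
by have := H (i, j); rewrite !inE nlinked_kercell => /(_ ij)/eqP.
Qed.

(** The coefficient at [tau] of [u] in the orbit basis of Delta_0, in which
    a set partition is the sum of the basis vectors of the partitions that
    it refines. *)
Definition orbit_coef tau u : k := \sum_(d | refines d tau) u d.

(** That is, [u] is a multiple of the orbit basis vector of [disc_cell]. *)
Definition singular u := forall tau, tau != disc_cell n -> orbit_coef tau u = 0.

(** The equations are triangular: at a finest partition [d] of the support
    of [u], [orbit_coef d u] reduces to [u d]. *)
Lemma singular_eq0 u : singular u -> u (disc_cell n) = 0 -> u = 0.
Proof.
move=> uS u0; apply/ffunP=> d0; rewrite ffunE; apply/eqP; apply: contraT => ud0.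
(* A finest partition in the support, as finer partitions have fewer
   links. *)
have [d ud dmin] := @arg_minnP _ d0 (fun d => u d != 0) (fun d => #|links d|) ud0.
have dd : d != disc_cell n by apply: contraNneq ud => ->; rewrite u0.
have := uS d dd; rewrite /orbit_coef (bigD1 d) /refines //= big1 ?addr0 => [E|v].
  by rewrite E eqxx in ud.
case/andP=> vd vnd; apply: contraNeq vnd => /dmin le.
by apply/eqP/links_inj/eqP; rewrite eqEcard vd.
Qed.

(** There is one equation fewer than there are unknowns. *)
Lemma singular_exists : exists2 w, w != 0 & singular w.
Proof.
pose f u : cell_space k n 0 :=
  [ffun tau => if tau == disc_cell n then 0 else orbit_coef tau u].
have lf : linear f.
  move=> c u v; apply/ffunP=> d; rewrite !ffunE; case: eqP => _.
    by rewrite [_ *: 0]mulr0 addr0.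
  rewrite /orbit_coef scaler_sumr -big_split; apply: eq_bigr => e _.
  by rewrite !ffunE.
pose F : {linear cell_space k n 0 -> cell_space k n 0} :=
  HB.pack f (GRing.isLinear.Build k _ _ *:%R f lf).
pose g := linfun F.
(* As an endomorphism, [g] is not surjective because its values vanish at
   [disc_cell]; hence it is not injective. *)
have gN : lker g != 0%VS.
  apply/negP => /lker0_limgf E.
  have : fbasis k (disc_cell n) \in limg g by rewrite E memvf.
  case/memv_imgP=> u _ /ffunP/(_ (disc_cell n)).
  by rewrite lfunE /= !ffunE eqxx => /eqP; rewrite oner_eq0.
exists (vpick (lker g)); first by rewrite vpick0.
move=> tau /negPf td; have := memv_pick (lker g).
rewrite memv_ker lfunE /= => /eqP/ffunP/(_ tau).
by rewrite !ffunE td.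
Qed.

Lemma refines_disc d : refines d (disc_cell n) = (d == disc_cell n).
Proof.
apply/idP/eqP => [/subsetP H|->]; last exact: subxx.
apply: cell0_ext => i j; rewrite nlinked_kercell /=.
apply/idP/eqP => [ij | ->]; last exact: linkedxx.
by have := H (i, j); rewrite !inE nlinked_kercell => /(_ ij)/eqP.
Qed.

Lemma disc_refines d : refines (disc_cell n) d.
Proof.
by apply/subsetP=> -[i j]; rewrite !inE nlinked_kercell => /eqP /= ->; apply: linkedxx.
Qed.

Lemma pair_cell_neq_disc (i j : 'I_n) : i != j -> pair_cell i j != disc_cell n.
Proof.
move=> ij; apply/eqP => /(congr1 (fun d => nlinked d i j)).
by rewrite !nlinked_kercell /= (negPf ij) !eqxx.
Qed.

Lemma nlinked_pair_cell (i j i' j' : 'I_n) : nlinked (pair_cell i j) i' j' ->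
  [|| i' == j', (i' == i) && (j' == j) | (i' == j) && (j' == i)].
Proof.
rewrite nlinked_kercell; case: (eqVneq i' j) => [->|i'j]; case: (eqVneq j' j) => [->|j'j].
- by rewrite eqxx.
- by move/eqP <-; rewrite !eqxx ?orbT.
- by move/eqP ->; rewrite !eqxx ?orbT.
- by move=> ->.
Qed.

(** Only [disc_cell] and [pair_cell i j] itself refine [pair_cell i j]. *)
Lemma orbit_coef_pair_cell i j u : i != j ->
  orbit_coef (pair_cell i j) u = u (disc_cell n) + u (pair_cell i j).
Proof.
move=> ij; rewrite /orbit_coef (bigD1 (disc_cell n)) ?disc_refines //=.
rewrite (bigD1 (pair_cell i j)) /refines ?subxx ?pair_cell_neq_disc //= big1 ?addr0 // => d.
case/andP=> /andP[/subsetP dp ddisc] /negP[]; rewrite -refines_disc in ddisc.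
case/subsetPn: ddisc => -[i' j']; rewrite !inE nlinked_kercell /= => d' nij.
have lij : nlinked d i j.
  have := dp (i', j'); rewrite !inE => /(_ d')/nlinked_pair_cell /=.
  rewrite (negPf nij) /= => /orP[|] /andP[/eqP E /eqP E']; first by rewrite -E -E'.
  by rewrite /nlinked linked_sym -E -E'.
apply/eqP/links_inj/setP=> -[i1 j1]; apply/idP/idP; first exact: dp.
rewrite !inE => /nlinked_pair_cell/or3P[/eqP|/andP[/eqP E /eqP E']|/andP[/eqP E /eqP E']] /=.
- by move=> /= ->; apply: linkedxx.
- by rewrite /= in E E' *; rewrite E E'.
- by rewrite /= in E E' *; rewrite E E' /nlinked linked_sym.
Qed.

Lemma singularZ c u : singular u -> singular (c *: u).
Proof.
move=> uS tau td; transitivity (c * orbit_coef tau u).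
  by rewrite mulr_sumr; apply: eq_bigr => d _; rewrite ffunE.
by rewrite uS // mulr0.
Qed.

Lemma fbasis_disc_not_singular : (1 < n)%N -> ~ singular (fbasis k (disc_cell n)).
Proof.
rewrite -[n in (_ < n)%N]card_ord => /card_gt1P[i [j [_ _ ij]]].
move=> /(_ _ (pair_cell_neq_disc ij)); rewrite orbit_coef_pair_cell // !ffunE eqxx.
by rewrite (negPf (pair_cell_neq_disc ij)) addr0 => /eqP; rewrite oner_eq0.
Qed.

End Refinement.

(** * The colouring map *)

Section Colouring.
Variables (k : fieldType) (n : nat) (T : finType) (t0 : T).
Local Notation cell0 := (cell_diagram n 0).
Local Notation delta := (#|T|%:R : k).
Implicit Types (d v tau : cell0) (u : cell_space k n 0).

(** The value at [c] of the image of [u] in the functions of colourings. *)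
Definition colour u (c : 'I_n -> T) : k := \sum_(d | ncompat d c) u d.

Lemma colourE u (c : 'I_n -> T) : colour u c = orbit_coef (kercell c) u.
Proof. by apply: eq_bigl => d; apply: ncompat_refines. Qed.

Lemma sum_ncompat x d (c : 'I_n -> T) :
  (ncompat (mulcell x d) c)%:R * delta ^+ loops x d =
  \sum_(b : {ffun 'I_n -> T} | compat x (glue c b)) (ncompat d b)%:R :> k.
Proof.
rewrite -natrX -natrM -(card_ncompat t0) -sum1_card natr_sum big_mkcond [RHS]big_mkcond.
by apply: eq_bigr => b _; rewrite inE; case: compat; case: ncompat.
Qed.

Lemma colour_sum u c : colour u c = \sum_d u d * (ncompat d c)%:R.
Proof.
by rewrite /colour big_mkcond; apply: eq_bigr => d _; case: ncompat; rewrite ?mulr1 ?mulr0.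
Qed.

(** The colouring map is a module homomorphism. *)
Lemma colour_act x u c : colour (cell_act delta (fbasis k x) u) c =
  \sum_(b : {ffun 'I_n -> T} | compat x (glue c b)) colour u b.
Proof.
under [RHS]eq_bigr => b _ do rewrite colour_sum.
rewrite exchange_big colour_sum.
under [LHS]eq_bigr => d' _ do rewrite cell_act_fbasis mulr_suml.
rewrite [LHS]exchange_big; apply: eq_bigr => d _ /=.
rewrite (bigD1 (mulcell x d)) //= big1 ?addr0 => [|d' /negPf dd'].
  by rewrite eqxx mulr1 -mulrA [_ ^+ _ * _]mulrC sum_ncompat mulr_sumr.
suff -> : (dmul x d == d') = false by rewrite mulr0 mul0r.
by apply: contraFF dd' => /eqP E; apply/eqP/val_inj.
Qed.

(** The product is always proportional to [d], with a factor given by the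
    bilinear form of [card_form]. *)
Lemma act_outerdiag d v u : cell_act delta (fbasis k (outerdiag d v)) u =
  (\sum_(b : {ffun 'I_n -> T} | ncompat v b) colour u b) *: fbasis k d.
Proof.
apply/ffunP=> d'; rewrite cell_act_fbasis ffunE.
have E (w : cell0) : (dmul (outerdiag d v) w == d') = (d' == d).
  rewrite eq_sym -[dmul _ _]/(cell_diag (mulcell (outerdiag d v) w)).
  by rewrite mulcell_outerdiag; apply: val_eqE.
rewrite ffunE; under eq_bigr => w _ do rewrite E.
rewrite -mulr_suml; congr (_ * _).
under [RHS]eq_bigr => b _ do rewrite colour_sum.
rewrite exchange_big; apply: eq_bigr => w _ /=.
rewrite -mulr_sumr; congr (_ * _).
rewrite -natrX -(card_form t0) -sum1_card natr_sum big_mkcond [RHS]big_mkcond.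
by apply: eq_bigr => b _; rewrite inE; do 2 case: ncompat.
Qed.

End Colouring.

(** * Characteristic p *)

Section KernelCount.
Variables (n : nat) (T : finType) (tau : cell_diagram n 0).

Let cls (i : 'I_n) := pblock (blocks tau) (inl i).
Let C := [set cls i | i : 'I_n].

(** A colouring with kernel [tau] is an injection from the blocks of [tau]
    to the colours. *)
Lemma card_kercell :
  #|[set c : {ffun 'I_n -> T} | kercell c == tau]| = #|T| ^_ #|C|.
Proof.
have CC i : cls i \in C by apply: imset_f.
pose cl i : {B | B \in C} := Sub (cls i) (CC i).
have clE i j : (cl i == cl j) = nlinked tau i j.
  by rewrite -val_eqE /= /nlinked linkedE.
have clS (B : {B | B \in C}) : {i | cl i = B}.
  apply: sig_eqW; case: B => B BC; have /imsetP[i _ E] := BC.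
  by exists i; apply: val_inj.
rewrite -[X in _ ^_ X]card_sig -card_inj_ffuns.
pose F (f : {ffun {B | B \in C} -> T}) := [ffun i => f (cl i)] : {ffun 'I_n -> T}.
have FI : injective F.
  move=> f g /ffunP fg; apply/ffunP=> B; have [i <-] := clS B.
  by have := fg i; rewrite !ffunE.
rewrite -(card_imset _ FI); congr #|pred_of_set _|; apply/setP=> c; rewrite inE.
apply/eqP/imsetP => [E | [f]].
  have cE i j : (c i == c j) = (cl i == cl j) by rewrite clE -E nlinked_kercell.
  exists [ffun B => c (sval (clS B))].
    rewrite inE; apply/injectiveP=> A B; rewrite !ffunE => /eqP; rewrite cE.
    by rewrite (svalP (clS A)) (svalP (clS B)) => /eqP.
  apply/ffunP=> i; rewrite !ffunE; apply/eqP; rewrite cE.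
  by rewrite (svalP (clS (cl i))).
rewrite inE => /injectiveP fI ->; apply: cell0_ext => i j.
by rewrite nlinked_kercell !ffunE (inj_eq fI) clE.
Qed.

Lemma card_classes : tau != disc_cell n -> (#|C| < n)%N.
Proof.
move=> td; rewrite ltn_neqAle andbC -[X in (_ <= X)%N]card_ord leq_imset_card /=.
apply: contraNneq td => Cn.
have /imset_injP cI : #|C| == #|'I_n| by rewrite Cn card_ord.
apply/eqP/cell0_ext => i j; rewrite nlinked_kercell /nlinked linkedE.
by apply/eqP/eqP => [|->] //; apply: cI.
Qed.

End KernelCount.

Section Socle.
Variables (k : fieldType) (p : nat).
Hypotheses (pchark : p \in [pchar k]) (p_gt2 : (2 < p)%N).

Let T : finType := 'I_(p.-1).
Let p1_gt0 : (0 < p.-1)%N. Proof. by case: p p_gt2 => [|[]]. Qed.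
Let t0 : T := Ordinal p1_gt0.
Let delta : k := (p - 1)%:R.
Let deltaE : delta = #|T|%:R. Proof. by rewrite card_ord -subn1. Qed.
Implicit Types (u w : cell_space k p 0) (tau : cell_diagram p 0).

Lemma card_kercell_neq0 tau : tau != disc_cell p ->
  #|[set c : {ffun 'I_p -> T} | kercell c == tau]|%:R != 0 :> k.
Proof.
move=> td; have p_pr := pcharf_prime pchark.
have := card_classes td; rewrite card_kercell card_ord; set m := #|_| => mp.
rewrite -(dvdn_pcharf pchark); apply: contraTN (prime_gt1 p_pr) => pd.
have pf : (p %| (p.-1)`!)%N.
  by rewrite -(@ffact_fact _ m) ?dvdn_mulr // -ltnS prednK // prime_gt0.
(* By Wilson, p divides (p-1)! + 1, so it cannot divide (p-1)! as well. *)
have := Wilson (prime_gt1 p_pr); rewrite p_pr -addn1 dvdn_addr // dvdn1.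
by move/esym/eqP => ->.
Qed.

(** No colouring of p nodes by p - 1 colours is injective, while every other
    partition is the kernel of some colouring. *)
Lemma singular_colour u :
  singular u <-> forall c : {ffun 'I_p -> T}, colour u c = 0.
Proof.
split=> [uS c | u0 tau td].
  rewrite colourE; apply: uS; apply/eqP => E.
  have /leq_card : injective c.
    by move=> i j /eqP; rewrite -(nlinked_kercell c) E nlinked_kercell => /eqP.
  by rewrite !card_ord leqNgt prednK ?leqnn // (ltn_trans _ p_gt2).
have := card_kercell_neq0 td.
have [c /eqP <- _ | no] := pickP (fun c : {ffun 'I_p -> T} => kercell c == tau).
  by rewrite -colourE u0.
by rewrite (eq_card0 (A := [set _ | _])) ?eqxx // => c; rewrite inE no.
Qed.

(** The singular vectors form the kernel of a module homomorphism. *)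
Lemma singular_stable x u : singular u -> singular (cell_act delta (fbasis k x) u).
Proof.
move=> /singular_colour u0; apply/singular_colour => c; rewrite deltaE.
by rewrite (colour_act t0) big1.
Qed.

(** By [singular_eq0] a singular vector is determined by its coefficient at
    [disc_cell]. *)
Lemma singular_proportional w u : w != 0 -> singular w -> singular u ->
  u = (u (disc_cell p) / w (disc_cell p)) *: w.
Proof.
move=> w0 wS uS; have wd : w (disc_cell p) != 0.
  by apply: contraNneq w0 => /(singular_eq0 wS) ->.
apply/eqP; rewrite -subr_eq0; apply/eqP/singular_eq0.
  move=> tau td; rewrite /orbit_coef.
  under eq_bigr => d _ do rewrite !ffunE.
  rewrite sumrB -scaler_sumr.
  by rewrite -!/(orbit_coef tau _) uS // wS // scaler0 subr0.
by rewrite !ffunE [_ *: _]mulfVK ?subrr.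
Qed.

(** The line of [w] is stable, so [x] acts on it by a scalar, which is read
    off at one coefficient. *)
Lemma singular_act w x : w != 0 -> singular w ->
  cell_act delta (fbasis k x) w = (npropag x == p)%:R *: w.
Proof.
move=> w0 wS; have wd : w (disc_cell p) != 0.
  by apply: contraNneq w0 => /(singular_eq0 wS) ->.
set xw := cell_act _ _ _.
have xwE d : xw d = \sum_v w v * delta ^+ loops x v * (mulcell x v == d)%:R.
  by rewrite cell_act_fbasis.
have xwS : singular xw by apply: singular_stable.
have xw0 d : (forall v, mulcell x v != d) -> xw d = 0.
  by move=> H; rewrite xwE big1 // => v _; rewrite (negPf (H v)) mulr0.
case: eqP => [/npropag_full[s xs] | xp]; rewrite (singular_proportional w0 wS xwS);
  congr (_ *: _).
  rewrite xwE xs (bigD1 (disc_cell p)) //= mulcell_perm_disc eqxx big1 => [|v /negPf vd].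
    by rewrite loops_perml expr0 !mulr1 addr0 divff.
  by rewrite mulcell_perm_disc vd mulr0.
suff -> : xw (disc_cell p) = 0 by rewrite mul0r.
(* If x joins the northern nodes i and j, so does every product x v, which
   is then not [disc_cell]. *)
case: (nonperm_north xp) => [[i [j [ij xij]]] | [i xi]].
  apply: xw0 => v; apply/eqP=> /(congr1 (fun d => nlinked d i j)).
  rewrite nlinked_kercell (negPf ij) => /negP[]; exact: linked_dmul_north.
(* If x isolates i, no product x v links i to j, so that x w vanishes at
   [pair_cell i j]; being singular, it then vanishes at [disc_cell]. *)
have [j ij] : exists j, i != j.
  have : (1 < #|'I_p|)%N by rewrite card_ord (ltn_trans _ p_gt2).
  case/card_gt1P=> j [l [_ _ jl]]; have [ij|] := eqVneq i j; last by exists j.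
  by exists l; rewrite ij.
have := xwS _ (pair_cell_neq_disc ij); rewrite orbit_coef_pair_cell // => /eqP.
rewrite addr_eq0 => /eqP ->; rewrite xw0 ?oppr0 // => v.
apply: contraNneq ij => E; have : nlinked (mulcell x v) i j.
  by rewrite E nlinked_kercell; case: (i == j); rewrite !eqxx.
by move/(singleton_dmul_north xi) => [->].
Qed.

(** The radical of the bilinear form consists of the singular vectors, since
    the form is diagonal in the orbit basis, with entries the numbers of
    colourings with a given kernel. *)
Lemma form_nonzero u : ~ singular u ->
  exists v, \sum_(b : {ffun 'I_p -> T} | ncompat v b) colour u b != 0.
Proof.
move=> uS.
have [tau0 P0] : exists tau, (tau != disc_cell p) && (orbit_coef tau u != 0).
  case: (pickP (fun tau => (tau != disc_cell p) && (orbit_coef tau u != 0))) => [tau|no].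
    by exists tau.
  by case: uS => tau td; have := no tau; rewrite td /= => /eqP.
(* A coarsest partition other than [disc_cell] with nonzero orbit
   coefficient: among the colourings constant on its blocks, only those with
   kernel exactly tau contribute. *)
have [tau /andP[td ut] tmax] := @arg_maxnP _ tau0
  (fun tau => (tau != disc_cell p) && (orbit_coef tau u != 0)) (fun d => #|links d|) P0.
exists tau; rewrite (bigID (fun b : {ffun 'I_p -> T} => kercell b == tau)) /=.
rewrite [X in _ + X]big1 ?addr0 => [|b /andP[]].
  rewrite (eq_big (fun c => c \in [set c : {ffun 'I_p -> T} | kercell c == tau])
    (fun=> orbit_coef tau u)) => [|b|b /andP[_ /eqP bt]].
  - by rewrite sumr_const -mulr_natl mulf_neq0 ?card_kercell_neq0.
  - rewrite inE; case: eqP => [bt|]; rewrite ?andbF //.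
    by rewrite ncompat_refines bt /refines subxx.
  - by rewrite colourE bt.
rewrite ncompat_refines colourE => tb bt; apply/eqP; apply: contraNT bt => ub.
rewrite eq_sym; apply/eqP/links_inj/eqP; rewrite eqEcard; apply/andP; split=> //.
apply: tmax; rewrite ub andbT; apply: contraNneq td => bd.
by rewrite -refines_disc -bd.
Qed.

End Socle.

(** * One-dimensional Specht modules *)

(** The situation common to the empty partition and to a row: all tableaux
    have the same tabloid and trivial column stabiliser. *)
Definition one_row t (la : intpartn t) : Prop :=
  forall T : 'S_t, tabloid la T = setT /\ col_stab la T = [set 1%g].

Lemma one_row_empty : one_row empty_partn.
Proof.
move=> T; split; apply/setP=> s; rewrite !inE; first by apply/forallP=> -[].
by rewrite (_ : s = 1%g) ?eqxx; [apply/forallP=> -[] | apply/permP=> -[]].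
Qed.

Lemma one_row_row t : one_row (row_partn t).
Proof.
have R (i : 'I_t) : reshape_index [:: t] i = 0%N.
  by rewrite /reshape_index /= (eqP (ltn_ord i)).
move=> T; split; apply/setP=> s; rewrite !inE.
  by apply/forallP=> e; rewrite /tab_row !R.
have O e : tab_col (row_partn t) T e = T e :> nat.
  by rewrite /tab_col /reshape_offset R subn0.
apply/forallP/eqP => [H | -> e]; last by rewrite perm1.
apply/permP=> e; rewrite perm1; apply: (@perm_inj _ T); apply: val_inj => /=.
by rewrite -!O; apply/eqP.
Qed.

Section OneRow.
Variables (k : fieldType) (t : nat) (la : intpartn t) (la1 : one_row la).

Lemma one_row_specht_vspace : specht_vspace k la = <[fbasis k setT]>%VS.
Proof.
have pE T : polytabloid k la T = fbasis k setT.
  have [_ cE] := la1 T; rewrite /polytabloid cE big_set1 odd_perm1 scale1r mul1g.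
  by have [->] := la1 T.
apply/eqP; rewrite eqEsubv; apply/andP; split.
  by apply/span_subvP=> _ /mapP[T _ ->]; rewrite pE memv_line.
apply/memv_span/mapP; exists 1%g; last by rewrite pE.
by rewrite mem_enum.
Qed.

(** As the Specht module is the line of the unique tabloid, the coefficient
    there is a linear coordinate on it. *)
Definition sp_coord (u : specht k la) : k := vsval u setT.

Lemma sp_coord_is_linear : linear_for *%R sp_coord.
Proof. by move=> c u v; rewrite /sp_coord linearP !ffunE. Qed.

HB.instance Definition _ := GRing.isLinear.Build k (specht k la) k
  *%R sp_coord sp_coord_is_linear.

Definition sp_gen : specht k la := vsproj (specht_vspace k la) (fbasis k setT).

Lemma sp_coord_gen : sp_coord sp_gen = 1.
Proof.
by rewrite /sp_coord vsprojK ?ffunE ?eqxx // one_row_specht_vspace memv_line.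
Qed.

Lemma sp_coordK u : u = sp_coord u *: sp_gen.
Proof.
apply: val_inj; have := subvsP u; rewrite [in X in _ \in X]one_row_specht_vspace.
case/vlineP=> c uE; rewrite /sp_coord linearZ /= vsprojK; last first.
  by rewrite one_row_specht_vspace memv_line.
by rewrite uE !ffunE eqxx [_ *: 1]mulr1.
Qed.

Lemma sp_coord_act s u : sp_coord (specht_act s u) = sp_coord u.
Proof.
rewrite /sp_coord vsprojK; last exact/specht_stable/subvsP.
have := subvsP u; rewrite [in X in _ \in X]one_row_specht_vspace.
case/vlineP=> c ->; rewrite linearZ /= tabloid_act_basis.
congr ((_ *: fbasis k _) _); apply/setP=> T; rewrite inE; apply/imsetP.
by exists (s^-1 * T)%g; rewrite ?mulKVg.
Qed.

Section Tensor.
Variables (delta : k) (n : nat) (le_tn : (t <= n)%N).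
Local Notation tspace := (tensor_space k n la).

Definition tcoord (w : tspace) : cell_space k n t := [ffun d => sp_coord (w d)].

Lemma tcoord_is_linear : linear tcoord.
Proof. by move=> c u v; apply/ffunP=> d; rewrite !ffunE linearP. Qed.

HB.instance Definition _ := GRing.isLinear.Build k tspace (cell_space k n t)
  *:%R tcoord tcoord_is_linear.

Lemma tcoord_tens v u : tcoord (tens v u) = sp_coord u *: v.
Proof. by apply/ffunP=> d; rewrite !ffunE linearZ /= mulrC. Qed.

Lemma tcoordK w : tens (tcoord w) sp_gen = w.
Proof. by apply/ffunP=> d; rewrite !ffunE -sp_coordK. Qed.

Lemma tcoord_act a w : tcoord (tensor_act delta a w) = cell_act delta a (tcoord w).
Proof.
rewrite linear_sum /=; apply/ffunP=> d'; rewrite sum_ffunE cell_actE.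
under eq_bigr => d _ do rewrite tcoord_tens ffunE cell_actE scaler_sumr.
rewrite exchange_big; apply: eq_bigr => x _ /=.
transitivity (\sum_d a x * (tcoord w d * delta ^+ loops x d * (dmul x d == d')%:R));
  last by rewrite mulr_sumr.
apply: eq_bigr => d _; rewrite (bigD1 d) //= [X in _ + X]big1 ?addr0.
  by rewrite !ffunE eqxx mul1r /GRing.scale /= mulrCA -!mulrA.
by move=> e /negPf ed; rewrite ffunE ed !mul0r.
Qed.

(** The symmetric group acts trivially on the Specht module, so the
    balancing relations identify the diagrams of one orbit. *)
Lemma tcoord_balanced d s u :
  tcoord (tens (fbasis k (cell_perm le_tn d s)) u
          - tens (fbasis k d) (specht_act s u))
  = sp_coord u *: (fbasis k (cell_perm le_tn d s) - fbasis k d).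
Proof. by rewrite linearB /= !tcoord_tens sp_coord_act scalerBr. Qed.

End Tensor.
End OneRow.

Lemma quot_pi_eq (k : fieldType) (V : vectType k) (W : {vspace V}) (v v' : V) :
  (quot_pi W v == quot_pi W v') = (v - v' \in W).
Proof.
rewrite -quot_pi_eq0 -subr_eq0; congr (_ == 0); symmetry.
by rewrite -[quot_pi W]/(_ : V -> _) /quot_pi !linearB.
Qed.

(** * The cell modules of the empty partition and of a row *)

Section DeltaEmpty.
Variables (k : fieldType) (delta : k) (n : nat).
Local Notation D0 := (Delta k (leq0n n) empty_partn).
Local Notation act0 := (@Delta_act k delta n 0 (leq0n n) empty_partn).
Let la1 := one_row_empty.

Lemma cell_perm0 (d : cell_diagram n 0) s : cell_perm (leq0n n) d s = d.
Proof.
apply/val_inj/val_inj => /=; rewrite /diag_perm_blocks.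
have E (B : {set node n}) : south_perm (leq0n n) s @: B = B.
  rewrite (eq_imset (g := id)) ?imset_id // => -[i|j] //=.
  by rewrite insubN.
by rewrite (eq_imset _ E) imset_id.
Qed.

(** For t = 0 the symmetric group is trivial and there is nothing to
    identify. *)
Lemma balanced_rel0 : balanced_rel k (leq0n n) empty_partn = 0%VS.
Proof.
apply/eqP; rewrite -subv0; apply/subv_sumP=> d _; apply/subv_sumP=> s _.
apply/span_subvP=> _ /mapP[u _ ->]; rewrite memv0; apply/eqP.
rewrite -[LHS](tcoordK la1) tcoord_balanced // cell_perm0 subrr scaler0.
by apply/ffunP=> e; rewrite !ffunE scale0r.
Qed.

Definition of_cell (v : cell_space k n 0) : D0 :=
  quot_pi _ (tens v (sp_gen k empty_partn)).
Definition to_cell (u : D0) : cell_space k n 0 := tcoord (vsval u).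

Lemma to_cell_is_linear : linear to_cell.
Proof. by move=> c u v; rewrite /to_cell !linearP. Qed.

HB.instance Definition _ := GRing.isLinear.Build k D0 (cell_space k n 0)
  *:%R to_cell to_cell_is_linear.

Lemma quot0K w : vsval (quot_pi (balanced_rel k (leq0n n) empty_partn) w) = w.
Proof.
by apply/eqP; rewrite -subr_eq0 -memv0 -balanced_rel0 -quot_pi_eq quot_pi_val.
Qed.

Lemma of_cellK v : to_cell (of_cell v) = v.
Proof. by rewrite /to_cell quot0K tcoord_tens sp_coord_gen // scale1r. Qed.

Lemma to_cellK u : of_cell (to_cell u) = u.
Proof. by rewrite /of_cell tcoordK // quot_pi_val. Qed.

Lemma to_cell_act a u : to_cell (act0 a u) = cell_act delta a (to_cell u).
Proof. by rewrite /to_cell quot0K tcoord_act. Qed.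

End DeltaEmpty.

Section DeltaRow.
Variables (k : fieldType) (delta : k) (n : nat).
Local Notation Dn := (Delta k (leqnn n) (row_partn n)).
Local Notation actn := (@Delta_act k delta n n (leqnn n) (row_partn n)).
Let la1 := @one_row_row n.

(** The sum of the coordinates is invariant under the symmetric group, hence
    is defined on the quotient by [augment_balanced]. *)
Definition augment (w : tensor_space k n (row_partn n)) : k^o := \sum_d tcoord w d.

Lemma augment_is_linear : linear augment.
Proof.
move=> c u v; rewrite scaler_sumr -big_split; apply: eq_bigr => d _.
by rewrite linearP !ffunE.
Qed.

HB.instance Definition _ := GRing.isLinear.Build k _ k^o
  *:%R augment augment_is_linear.

Lemma sum_fbasis (I : finType) (i : I) : \sum_j fbasis k i j = 1.
Proof.
rewrite (bigD1 i) //= big1 ?addr0 => [|j /negPf ji]; first by rewrite ffunE eqxx.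
by rewrite ffunE ji.
Qed.

Lemma augment_balanced w : w \in balanced_rel k (leqnn n) (row_partn n) ->
  augment w = 0.
Proof.
have H : (balanced_rel k (leqnn n) (row_partn n) <= lker (linfun augment))%VS.
  apply/subv_sumP=> d _; apply/subv_sumP=> s _; apply/span_subvP=> _ /mapP[u _ ->].
  rewrite memv_ker lfunE /= /augment tcoord_balanced //.
  have cE (c : k) (v v' : cell_space k n n) :
      \sum_e (c *: (v - v')) e = c *: (\sum_e v e - \sum_e v' e).
    rewrite -sumrB scaler_sumr; apply: eq_bigr => e _.
    by rewrite [LHS]ffunE; congr (_ *: _); rewrite !ffunE.
  rewrite cE [X in _ *: X](_ : _ = 0) ?scaler0 //; apply/eqP; rewrite subr_eq0.
  exact/eqP/(etrans (sum_fbasis _) (esym (sum_fbasis _))).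
by move/(subvP H); rewrite memv_ker lfunE => /eqP.
Qed.

Definition Delta_augment (u : Dn) : k^o := augment (vsval u).

Lemma Delta_augment_is_linear : linear Delta_augment.
Proof. by move=> c u v; rewrite /Delta_augment !linearP. Qed.

HB.instance Definition _ := GRing.isLinear.Build k Dn k^o
  *:%R Delta_augment Delta_augment_is_linear.

Lemma Delta_augment_quot w : Delta_augment (quot_pi _ w) = augment w.
Proof.
apply/eqP; rewrite -subr_eq0 /Delta_augment -linearB; apply/eqP/augment_balanced.
by rewrite -quot_pi_eq quot_pi_val.
Qed.

Lemma cell_full_perm (d : cell_diagram n n) :
  exists s, cell_diag d = permdiag s.
Proof. by apply/npropag_full; have /andP[/eqP] := cell_diagP d. Qed.

(** A product with a permutation diagram has n propagating blocks iff the
    other factor is a permutation diagram; it then involves no loop. *)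
Lemma augment_act a w :
  augment (tensor_act delta a w) = (\sum_(x | npropag x == n) a x) * augment w.
Proof.
rewrite /augment tcoord_act //.
under eq_bigr => d' _ do rewrite cell_actE.
rewrite exchange_big mulr_suml [RHS]big_mkcond; apply: eq_bigr => x _ /=.
rewrite -mulr_sumr exchange_big /=.
case: eqP => xn; last first.
  rewrite big1 ?mulr0 // => d _; rewrite big1 // => d' _.
  suff -> : (dmul x d == d') = false by rewrite mulr0.
  apply/eqP => E; case: xn; have [s ds] := cell_full_perm d.
  by apply/(npropag_dmul_permr x s); rewrite -ds E; have /andP[/eqP] := cell_diagP d'.
congr (_ * _); apply: eq_bigr => d _; have [s ds] := cell_full_perm d.
have xd : npropag (dmul x d) = n by rewrite ds; apply/npropag_dmul_permr.
rewrite (bigD1 (CellDiagram (dmul_cell xd))) //= big1 ?addr0 => [|d' /negPf dd'].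
  by rewrite eqxx mulr1 ds loops_permr mulr1.
suff -> : (dmul x d == d') = false by rewrite mulr0.
by apply: contraFF dd' => /eqP E; apply/eqP/val_inj.
Qed.

Lemma Delta_augment_act a u :
  Delta_augment (actn a u) = (\sum_(x | npropag x == n) a x) * Delta_augment u.
Proof. by rewrite Delta_augment_quot augment_act. Qed.

Lemma compat_diag_perm (T : eqType) d (s : 'S_n) (a c : 'I_n -> T) :
  compat (diag_perm (leqnn n) d s) (glue a c) = compat d (glue a (c \o s)).
Proof.
have sE : south_perm (leqnn n) s =1
    fun u => match u with inl i => inl i | inr j => inr (s j) end.
  case=> //= j; congr inr; have -> : insub (val j) = Some j by rewrite valK.
  exact: val_inj.
have jE u : glue a c (south_perm (leqnn n) s u) = glue a (c \o s) u.
  by rewrite sE; case: u.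
have lE u v : linked (diag_perm (leqnn n) d s) (south_perm (leqnn n) s u)
    (south_perm (leqnn n) s v) = linked d u v.
  have Bd : south_perm (leqnn n) s @: pblock (blocks d) u
      \in blocks (diag_perm (leqnn n) d s) by apply/imset_f/pblock_blocks.
  rewrite (linked_block _ Bd); last exact/imset_f/linkedxx.
  by rewrite (mem_imset _ _ (can_inj (south_permK (leqnn n) s))).
apply/compatP/compatP => H u v uv; first by rewrite -!jE; apply: H; rewrite lE.
have K := south_permK (leqnn n) s^-1%g; rewrite invgK in K.
by rewrite -(K u) -(K v) !jE; apply: H; rewrite -lE !K.
Qed.

Lemma cell_id_subproof : is_cell_diagram n (@permdiag n 1).
Proof.
apply/andP; split; first by apply/eqP/npropag_full; exists 1%g.
by apply/forallP=> j; rewrite leqNgt ltn_ord.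
Qed.

Definition cell_id : cell_diagram n n := CellDiagram cell_id_subproof.

Lemma cell_perm_transitive (d : cell_diagram n n) :
  exists s, d = cell_perm (leqnn n) cell_id s.
Proof.
have [s ds] := cell_full_perm d; exists s.
apply/val_inj/(@compat_ext _ _ _ _ false true) => // a c /=.
rewrite compat_diag_perm ds !compat_permdiag.
by apply: eq_forallb => i /=; rewrite perm1.
Qed.

(** The cell diagrams with n propagating blocks form a single orbit of the
    symmetric group, so modulo the balancing relations every vector is
    supported on [cell_id]. *)
Lemma Delta_augment_eq0 u : Delta_augment u = 0 -> u = 0.
Proof.
rewrite -(quot_pi_val u); set w := vsval u; rewrite Delta_augment_quot => w0.
apply/eqP; rewrite quot_pi_eq0.
have wE : w = \sum_d tens (fbasis k d) (w d).
  apply/ffunP=> d; rewrite sum_ffunE (bigD1 d) //= big1 ?addr0 => [|e /negPf ed].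
    by rewrite !ffunE eqxx scale1r.
  by rewrite !ffunE eq_sym ed scale0r.
(* Moving all coordinates of [w] to [cell_id] gives their sum, which is 0,
   so [w] equals the sum of the displacements. *)
have -> : w = \sum_d (tens (fbasis k d) (w d) - tens (fbasis k cell_id) (w d)).
  rewrite sumrB [X in _ - X](_ : _ = 0).
    by rewrite subr0; exact: wE.
  apply/ffunP=> d; rewrite sum_ffunE !ffunE.
  under eq_bigr => e _ do rewrite !ffunE.
  rewrite -scaler_sumr [X in _ *: X](_ : _ = 0) ?scaler0 //.
  rewrite (sp_coordK la1 (\sum_e w e)) linear_sum /=.
  rewrite [X in X *: _](_ : _ = 0) ?scale0r //; rewrite -[RHS]w0.
  by apply: eq_bigr => e _; rewrite ffunE.
apply: rpred_sum => d _; have [s ->] := cell_perm_transitive d.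
set v := w _; have := balanced_relP (leqnn n) cell_id s v.
suff -> : specht_act s v = v by [].
by rewrite (sp_coordK la1 (specht_act s v)) sp_coord_act // -sp_coordK.
Qed.

Lemma Delta_augment_one : exists u, Delta_augment u = 1.
Proof.
exists (quot_pi _ (tens (fbasis k cell_id) (sp_gen k (row_partn n)))).
by rewrite Delta_augment_quot /augment tcoord_tens sp_coord_gen // scale1r sum_fbasis.
Qed.

End DeltaRow.

(** * Submodules and composition series *)

(** The submodules form a chain of three terms, and a composition series has
    to visit each of them. *)
Lemma unique_composition_series3 (k : fieldType) (A : Type) (V : vectType k)
    (act : A -> V -> V) (L : {vspace V}) :
  L != 0%VS -> L != fullv -> submodule act 0%VS -> submodule act L ->
  (forall U, submodule act U -> [\/ U = 0%VS, U = L | U = fullv]) ->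
  unique (composition_series act) [:: 0%VS; L; fullv].
Proof.
move=> L0 L1 S0 SL all3; have SV : submodule act fullv by move=> a v _; apply: memvf.
split.
  split=> // [U|[|[|i]]] //.
  - by rewrite !inE => /or3P[] /eqP ->.
  - move=> _; split=> //=; rewrite ?sub0v 1?eq_sym // => X /all3[] -> //; first by left.
      by right.
    by move=> _ fL; case/eqP: L1; apply/eqP; rewrite eqEsubv subvf.
  - move=> _; split=> //=; rewrite ?subvf // => X /all3[] -> //; [|by left|by right].
    by rewrite subv0 (negPf L0).
case=> [|U0 s] [//= [->] lasts subs maxs].
case: s => [|A1 s] in lasts subs maxs *.
  by case/eqP: L1; apply/eqP; rewrite eqEsubv subvf -lasts sub0v.
have A1L : A1 = L.
  have [_ _ A10 A1max] := maxs 0%N isT.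
  have A1S : submodule act A1 by apply: subs; rewrite !inE eqxx orbT.
  have [E|//|E] := all3 A1 A1S.
  - by rewrite E eqxx in A10.
  - have LA1 : (L <= A1)%VS by rewrite E subvf.
    have [E'|E'] := A1max L SL (sub0v _) LA1; first by rewrite E' eqxx in L0.
    by rewrite E' E eqxx in L1.
case: s => [|A2 s] in lasts subs maxs *.
  by rewrite /= A1L in lasts; rewrite lasts eqxx in L1.
have A2V : A2 = fullv.
  have [_ le12 ne12 _] := maxs 1%N isT; rewrite /= A1L in le12 ne12.
  have A2S : submodule act A2 by apply: subs; rewrite !inE eqxx !orbT.
  have [E|E|//] := all3 A2 A2S.
  - by rewrite E subv0 (negPf L0) in le12.
  - by rewrite E eqxx in ne12.
case: s => [|A3 s] in lasts subs maxs *; first by rewrite A1L A2V.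
have [_ le23 ne23 _] := maxs 2%N isT; rewrite /= A2V in le23 ne23.
by case/eqP: ne23; apply/eqP; rewrite eqEsubv le23 subvf.
Qed.

Section Submodules.
Variables (k : fieldType) (p : nat).
Hypotheses (pchark : p \in [pchar k]) (p_gt2 : (2 < p)%N).
Let delta : k := (p - 1)%:R.
Local Notation act0 := (@Delta_act k delta p 0 (leq0n p) empty_partn).
Variables (w : cell_space k p 0) (w0 : w != 0) (wS : singular w).

Local Notation of_cell := (@of_cell k p).

Lemma of_cell_is_linear : linear of_cell.
Proof.
move=> c u v; apply: (can_inj (@to_cellK k p)).
by rewrite linearP /= !of_cellK.
Qed.

HB.instance Definition _ := GRing.isLinear.Build k (cell_space k p 0)
  (Delta k (leq0n p) empty_partn) *:%R of_cell of_cell_is_linear.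

Lemma act0_of_cell a v : act0 a (of_cell v) = of_cell (cell_act delta a v).
Proof. by rewrite -[LHS]to_cellK to_cell_act of_cellK. Qed.

Lemma of_cell_eq0 v : (of_cell v == 0) = (v == 0).
Proof.
apply/eqP/eqP => [v0 | ->]; last by rewrite linear0.
by rewrite -(of_cellK v) v0 linear0.
Qed.

Lemma cell_actZ a c (v : cell_space k p 0) :
  cell_act delta a (c *: v) = c *: cell_act delta a v.
Proof.
apply/ffunP=> d; rewrite [RHS]ffunE !cell_actE scaler_sumr.
apply: eq_bigr => x _; rewrite /GRing.scale /= mulrCA; congr (_ * _).
rewrite mulr_sumr; apply: eq_bigr => d' _.
by rewrite ffunE /GRing.scale /= !mulrA.
Qed.

Lemma act0Z a c u : act0 a (c *: u) = c *: act0 a u.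
Proof.
apply: (can_inj (@to_cellK k p)).
by rewrite linearZ /= !to_cell_act linearZ /= cell_actZ.
Qed.

Lemma act0_singular a :
  act0 a (of_cell w) = (\sum_(x | npropag x == p) a x) *: of_cell w.
Proof.
rewrite act0_of_cell cell_act_basis -linearZ; congr of_cell.
rewrite scaler_suml [RHS]big_mkcond; apply: eq_bigr => x _.
rewrite (singular_act pchark p_gt2 x w0 wS) scalerA.
by case: eqP; rewrite ?mulr1 // mulr0 scale0r.
Qed.

Lemma cell_basisE n t (v : cell_space k n t) : v = \sum_d v d *: fbasis k d.
Proof.
apply/ffunP=> d; rewrite sum_ffunE (bigD1 d) //= big1 ?addr0 => [|e /negPf ed].
  by rewrite !ffunE eqxx [_ *: 1]mulr1.
by rewrite !ffunE eq_sym ed [_ *: 0]mulr0.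
Qed.

(** A submodule inside the line of [w] is 0 or this line.  Any other
    contains a vector on which the form does not vanish, hence all multiples
    of basis diagrams by [act_outerdiag]. *)
Lemma submodule_Delta0 U : submodule act0 U ->
  [\/ U = 0%VS, U = <[of_cell w]>%VS | U = fullv].
Proof.
move=> subU; have [UW|/subvPn[u uU uW]] := boolP (U <= <[of_cell w]>)%VS.
  have [U0|U0] := eqVneq U 0%VS; [exact: Or31|apply: Or32].
  apply/eqP; rewrite eqEsubv UW -memvE.
  have := memv_pick U; have /vlineP[c E] := subvP UW _ (memv_pick U).
  have c0 : c != 0.
    by apply: contraNneq U0 => c0; rewrite -vpick0 E c0 scale0r.
  by move/(memvZ c^-1); rewrite E scalerA mulVf // scale1r.
apply: Or33; apply/eqP; rewrite eqEsubv subvf /=; apply/subvP=> z _.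
(* A singular vector would be proportional to [w]. *)
have uS : ~ singular (to_cell u).
  move=> /(singular_proportional w0 wS) uE; case/negP: uW.
  by rewrite -(to_cellK u) uE linearZ /= memvZ // memv_line.
have [v vu] := form_nonzero pchark uS.
have basU d : of_cell (fbasis k d) \in U.
  have := subU (fbasis k (outerdiag d v)) u uU.
  have dE : delta = #|'I_p.-1|%:R by rewrite card_ord -subn1.
  have p1_gt0 : (0 < p.-1)%N by case: p p_gt2 => [|[]].
  rewrite -{1}(to_cellK u) act0_of_cell dE (act_outerdiag (Ordinal p1_gt0)).
  set c := (X in of_cell (X *: _)); rewrite linearZ => /(memvZ c^-1).
  by rewrite scalerA mulVf ?scale1r.
rewrite -(to_cellK z) (cell_basisE (to_cell z)) linear_sum rpred_sum // => d _.
by rewrite linearZ /= memvZ //.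
Qed.

End Submodules.

Theorem lemma5p16 (p : nat) (K : fieldType) (R : idomainType) (k : fieldType)
    (sys : pmodular_system p K R k) (p_gt2 : (2 < p)%N) :
  let delta : k := (p - 1)%:R in
  let Delta_p := Delta k (leqnn p) (row_partn p) in
  let Delta_0 := Delta k (leq0n p) empty_partn in
  let act_p := @Delta_act k delta p p (leqnn p) (row_partn p) in
  let act_0 := @Delta_act k delta p 0 (leq0n p) empty_partn in
  exists f : 'Hom(Delta_p, Delta_0),
    [/\ module_hom act_p act_0 f,
        lker f = 0%VS
      & unique (composition_series act_0) [:: 0%VS; limg f; fullv]].
Proof.
have pk := pms_pchark sys.
move=> delta Delta_p Delta_0 act_p act_0.
have [w w0 wS] := singular_exists k p.
pose W : Delta_0 := of_cell w; have W0 : W != 0 by rewrite of_cell_eq0.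
have act_W a : act_0 a W = (\sum_(x | npropag x == p) a x) *: W by apply: act0_singular.
have act_Z a c u : act_0 a (c *: u) = c *: act_0 a u by apply: act0Z.
pose f0 (u : Delta_p) : Delta_0 := Delta_augment u *: W.
have lf0 : linear f0 by move=> c u v; rewrite /f0 linearP scalerDl scalerA.
pose F : {linear Delta_p -> Delta_0} :=
  HB.pack f0 (GRing.isLinear.Build k _ _ *:%R f0 lf0).
pose f := linfun F; have fE u : f u = Delta_augment u *: W by rewrite lfunE.
have limgE : limg f = <[W]>%VS.
  apply/eqP; rewrite eqEsubv; apply/andP; split.
    by apply/subvP=> _ /memv_imgP[u _ ->]; rewrite fE memvZ // memv_line.
  have [u u1] := Delta_augment_one k p.
  by rewrite -memvE -[W]scale1r -u1 -fE memv_img ?memvf.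
exists f; split.
- move=> a u; rewrite !fE act_Z act_W.
  by rewrite (Delta_augment_act delta a u) scalerA mulrC.
- apply/eqP; rewrite -subv0; apply/subvP=> u; rewrite memv_ker fE memv0.
  by rewrite scaler_eq0 (negPf W0) orbF => /eqP/Delta_augment_eq0 ->.
rewrite limgE; apply: unique_composition_series3.
- by apply: contraNneq W0 => W0; rewrite -memv0 -W0 memv_line.
(* The line of [w] is proper: its vectors are singular, but [disc_cell] is
   not. *)
- apply/eqP => full.
  have /vlineP[c] : of_cell (fbasis k (disc_cell p)) \in <[W]>%VS by rewrite full memvf.
  rewrite -linearZ => /(can_inj (@of_cellK k p)) E.
  by apply: (@fbasis_disc_not_singular k p (ltnW p_gt2)); rewrite E; apply: singularZ.
- move=> a v; rewrite !memv0 => /eqP ->.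
  by rewrite -[X in act_0 a X](scale0r W) act_Z scale0r.
- by move=> a v /vlineP[c ->]; rewrite act_Z act_W !memvZ // memv_line.
- exact: submodule_Delta0.
Qed.
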